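(* Let $f:\mathbb{C}\to\mathbb{C}$ be an entire function of exponential type. There exists a symmetric convex compact neighbourhood $A$ of $0$ in $\mathbb{C}$ such that the following three properties hold. (i) For all $(x,y,z)\in A\times\mathbb{C}^2$ and all $\lambda\in\mathbb{C}\setminus\{0,-1,\ldots,-n,\ldots\}$, $$\sum_{p=0}^{\infty}\frac{1}{p+\lambda}\frac{\left(z+(p+\lambda)x\right)^{p}}{p!}D^{p}f\left(y-(p+\lambda)x\right)=\sum_{p=0}^{\infty}\frac{1}{p+\lambda}\frac{z^{p}}{p!}D^{p}f(y).$$ (ii) For all $(x,\lambda)\in A\times\mathbb{C}$, $$f(\lambda x)=f(0)+\lambda\sum_{p=1}^{\infty}(\lambda-p)^{p-1}\frac{x^{p}}{p!}D^{p}f(px).$$ (iii) For all $x\in A$ and every integer $m\ge 1$, $$\frac{1}{m!}D^{m}f(0)=\sum_{p=m}^{\infty}\binom{p-1}{m-1}\frac{(-1)^{p-m}p^{p-m}}{p!}x^{p-m}D^{p}f(px).$$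
   Context: $D^pf$ denotes the $p$-th complex derivative of $f$. An entire function $f$ is of exponential type if there are constants $C,K>0$ with $|f(z)|\le Ce^{K|z|}$ for all $z\in\mathbb{C}$ (equivalently, there are $C,K>0$ with $|D^nf(0)|\le CK^n$ for all $n\in\mathbb{N}$). Zeroth powers are equal to $1$ (including $0^0=1$). *)

(* Defs.v *)
From Stdlib Require Import Reals Factorial List.
From Coquelicot Require Import Coquelicot.

Definition entire (f : C -> C) : Prop :=
  forall z : C, ex_derive (K := C_AbsRing) (V := C_NormedModule) f z.

Definition exponential_type (f : C -> C) : Prop :=
  exists M K : R, (0 < M)%R /\ (0 < K)%R /\
    forall z : C, (Cmod (f z) <= M * exp (K * Cmod z))%R.

(* Complex counterpart of [Derive_n].  The total operator [C_derive] is the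
   complex derivative wherever the function is complex differentiable
   ([C_derive_correct]), hence everywhere for entire functions. *)
Fixpoint C_derive_n (f : C -> C) (p : nat) (z : C) : C :=
  match p with
  | O => f z
  | S q => C_derive (C_derive_n f q) z
  end.

Definition is_series_from (m : nat) (a : nat -> C) (l : C) : Prop :=
  is_series (fun k : nat => a (m + k)%nat) l.

Definition symmetric_set (A : C -> Prop) : Prop :=
  forall x : C, A x -> A (- x)%C.

Definition convex_set (A : C -> Prop) : Prop :=
  forall (x y : C) (t : R), A x -> A y -> (0 <= t <= 1)%R ->
    A (RtoC t * x + RtoC (1 - t) * y)%C.

Definition compact_set (A : C -> Prop) : Prop :=
  forall F : (C -> Prop) -> Prop,
    (forall U : C -> Prop, F U -> open U) ->
    (forall x : C, A x -> exists U : C -> Prop, F U /\ U x) ->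
    exists l : list (C -> Prop),
      (forall U : C -> Prop, In U l -> F U) /\
      (forall x : C, A x -> exists U : C -> Prop, In U l /\ U x).

(* Main.v *)
Require Import Defs.
From Stdlib Require Import Reals Factorial List.
From Stdlib Require Import Lra Lia Classical ClassicalEpsilon FunctionalExtensionality.
From Coquelicot Require Import Coquelicot.

(** The three identities share one mechanism.  Each left-hand side is a series whose
    [p]-th term is a factor [g p] times the [p]-th derivative of [f] at a point
    [y + w p], where [w p] is an affine function of [p] with slope [x] or [- x].
    Expanding that derivative in a Taylor series at [y] produces a double series in
    [p] and [n] which involves the derivative of order [p + n] of [f] at [y].  If it
    converges absolutely, it may be summed along [p + n = N], and the identity reduces
    to the computation, for every [N], of the finite sum which multiplies the
    derivative of order [N].

    These finite sums are evaluated by one principle: the [N]-th difference of a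
    polynomial of degree less than [N] vanishes.  For (i), expand
    [(z + (p + lambda) x) ^ p] in powers of [z]; the coefficient of [z ^ j] is a
    difference of order [N - j] of the polynomial [(p + lambda) ^ (N - j - 1)], hence
    [0] unless [j = N] ([shifted_difference], [shifted_sum_coefficient]).  For (iii),
    the sum is the [N]-th difference of the polynomial
    [p ^ (N - m) (p - 1) ... (p - m + 1)] of degree [N - 1] ([abel_coefficient]).  For
    (ii), expanding [(lambda - p) ^ (p - 1)] in powers of [lambda] leads to the same
    sums and proves an identity of Abel ([abel_sum]).

    Absolute convergence is where exponential type and the smallness of [x] enter.  If
    the derivatives at [y] are [O(L ^ n)] and [r = L * Cmod x], the terms of the double
    series are dominated, up to constants, by [(p r) ^ p / p!] times
    [(p r) ^ n / n!].  As [t ^ p / p! <= exp t], the first factor is at most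
    [(r * exp 1) ^ p], while the sum over [n] of the second is [exp (r p)]; both are
    harmless for small [r].  The value [r = 1/36] leaves room for the bound [2 ^ p] on
    the binomial coefficients in (iii) and gives domination by [2 ^ -(p + n)]
    ([taylor_rearrangement], [double_series_diagonal]).

    It remains to prove that an entire function, here a function complex differentiable
    at every point, has a Taylor series, with derivatives [O(L ^ n)] when it has
    exponential type.  Goursat's bisection argument is carried out for the form
    [f(z) dz / (z - a)] in logarithmic polar coordinates around [a], along paths that are
    star-shaped around [a] ([loop_zero]).  Letting the path shrink to [a] gives Cauchy's
    formula without any removable singularity ([cauchy_star]); expanding the Cauchy
    kernel on a circle gives the power series with the Cauchy estimates
    ([cauchy_power_series]).  By uniqueness of the coefficients all radii give the same
    series, and the estimate of the [n]-th coefficient on the circle of radius [n] gives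
    the bound with [L = exp K] ([entire_power_series], [entire_taylor]). *)

Open Scope R_scope.

Notation is_Cseries := (is_series (K := C_AbsRing) (V := C_NormedModule)).
Notation is_Cderive := (is_derive (K := C_AbsRing) (V := C_NormedModule)).

(** * Finite sums and geometrically convergent series *)

(** The sum over [k < n]: with an exclusive bound the empty sum exists, and
    splittings of an index range carry no predecessor. *)
Fixpoint csum (a : nat -> C) (n : nat) : C :=
  match n with
  | O => 0
  | S k => (csum a k + a k)%C
  end.

Lemma csum_sum_n (a : nat -> C) (n : nat) :
  sum_n (a : nat -> C_NormedModule) n = csum a (S n).
Proof.
  induction n as [|n IH].
  - rewrite sum_O. simpl. ring.
  - rewrite sum_Sn, IH. reflexivity.
Qed.

Lemma csum_ext (a b : nat -> C) (n : nat) :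
  (forall k, (k < n)%nat -> a k = b k) -> csum a n = csum b n.
Proof.
  induction n as [|n IH]; intros H; simpl; [reflexivity|].
  rewrite IH by (intros; apply H; lia). rewrite H by lia. reflexivity.
Qed.

Lemma csum_plus (a b : nat -> C) (n : nat) :
  csum (fun k => a k + b k)%C n = (csum a n + csum b n)%C.
Proof. induction n as [|n IH]; simpl; [ring|]. rewrite IH. ring. Qed.

Lemma csum_scal (c : C) (a : nat -> C) (n : nat) :
  csum (fun k => c * a k)%C n = (c * csum a n)%C.
Proof. induction n as [|n IH]; simpl; [ring|]. rewrite IH. ring. Qed.

Lemma csum_zero (a : nat -> C) (n : nat) :
  (forall k, (k < n)%nat -> a k = RtoC 0) -> csum a n = RtoC 0.
Proof.
  induction n as [|n IH]; intros H; simpl; [reflexivity|].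
  rewrite IH by (intros; apply H; lia). rewrite H by lia. ring.
Qed.

Lemma csum_shift (a : nat -> C) (n : nat) :
  csum a (S n) = (a O + csum (fun k => a (S k)) n)%C.
Proof.
  induction n as [|n IH]; [simpl; ring|].
  change (csum a (S (S n))) with (csum a (S n) + a (S n))%C.
  rewrite IH. simpl. ring.
Qed.

Lemma csum_split (a : nat -> C) (m n : nat) :
  csum a (m + n) = (csum a m + csum (fun k => a (m + k)%nat) n)%C.
Proof.
  induction n as [|n IH].
  - rewrite Nat.add_0_r. simpl. ring.
  - rewrite Nat.add_succ_r. simpl. rewrite IH. ring.
Qed.

Lemma Cmod_csum_le (a : nat -> C) (n : nat) (B : R) :
  (forall k, (k < n)%nat -> Cmod (a k) <= B) -> Cmod (csum a n) <= INR n * B.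
Proof.
  induction n as [|n IH]; intros H.
  - simpl. rewrite Cmod_0. lra.
  - rewrite S_INR. simpl csum.
    eapply Rle_trans; [apply Cmod_triangle|].
    specialize (H n) as Hn. specialize (Hn ltac:(lia)).
    assert (Cmod (csum a n) <= INR n * B) by (apply IH; intros; apply H; lia).
    lra.
Qed.

Lemma Cmod_minus_sym (x y : C) : Cmod (x - y) = Cmod (y - x).
Proof. rewrite <- Cmod_opp. f_equal. ring. Qed.

Lemma Cmod_triangle_minus (x y z : C) :
  Cmod (x - z) <= Cmod (x - y) + Cmod (y - z).
Proof.
  replace (x - z)%C with ((x - y) + (y - z))%C by ring. apply Cmod_triangle.
Qed.

Lemma is_series_squeeze (a : nat -> C) (l : C) (u : nat -> R) :
  (forall n, Cmod (csum a n - l) <= u n) -> is_lim_seq u 0 ->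
  is_Cseries a l.
Proof.
  intros H Hu.
  apply (filterlim_locally_ball_norm (K := C_AbsRing) (U := C_NormedModule)).
  intros eps.
  apply is_lim_seq_spec in Hu. destruct (Hu eps) as [N HN].
  exists N. intros n Hn. unfold ball_norm.
  rewrite csum_sum_n.
  change (Cmod (csum a (S n) - l) < eps).
  specialize (HN (S n) ltac:(lia)). specialize (H (S n)).
  rewrite Rminus_0_r in HN. apply Rabs_def2 in HN. lra.
Qed.

Lemma is_series_C_eps (a : nat -> C) (l : C) (eps : R) :
  is_Cseries a l -> 0 < eps ->
  exists N, forall n, (N <= n)%nat -> Cmod (csum a n - l) < eps.
Proof.
  intros H He.
  unfold is_series in H.
  pose proof (proj1 (filterlim_locally_ball_norm (K := C_AbsRing) (U := C_NormedModule) _ _) H) as H'.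
  destruct (H' (mkposreal eps He)) as [N HN].
  exists (S N). intros n Hn. destruct n as [|n]; [lia|].
  specialize (HN n ltac:(lia)). unfold ball_norm in HN.
  rewrite csum_sum_n in HN. exact HN.
Qed.

Lemma is_series_C_unique (a : nat -> C) (l l' : C) :
  is_Cseries a l ->
  is_Cseries a l' -> l = l'.
Proof.
  intros H H'. exact (filterlim_locally_unique _ _ _ H H').
Qed.

Lemma half_pow_pos (n : nat) : 0 < (1/2)^n.
Proof. apply pow_lt. lra. Qed.

(** Every series below is dominated by a geometric one of ratio [1/2].  Working
    with this explicit rate makes all interchanges of limits quantitative. *)
Lemma geometric_tail (a : nat -> C) (l : C) (M : R) :
  (forall n, Cmod (a n) <= M * (1/2)^n) ->
  is_Cseries a l ->
  forall n, Cmod (l - csum a n) <= 2 * M * (1/2)^n.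
Proof.
  intros Ha Hl n.
  assert (Hk : forall k, Cmod (csum a (n + k) - csum a n)
      <= 2 * M * (1/2)^n * (1 - (1/2)^k)).
  { induction k as [|k IH].
    - rewrite Nat.add_0_r. replace (csum a n - csum a n)%C with (RtoC 0) by ring.
      rewrite Cmod_0. simpl. lra.
    - rewrite Nat.add_succ_r. simpl csum.
      replace (csum a (n + k) + a (n + k)%nat - csum a n)%C
        with ((csum a (n + k) - csum a n) + a (n + k)%nat)%C by ring.
      eapply Rle_trans; [apply Cmod_triangle|].
      specialize (Ha (n + k)%nat). rewrite pow_add in Ha. simpl pow. lra. }
  assert (HM : 0 <= M).
  { specialize (Ha O). simpl in Ha. pose proof (Cmod_ge_0 (a O)). lra. }
  apply le_epsilon. intros eps He.
  destruct (is_series_C_eps a l eps Hl He) as [N HN].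
  specialize (HN (n + N)%nat ltac:(lia)). specialize (Hk N).
  pose proof (Cmod_triangle_minus l (csum a (n + N)) (csum a n)).
  rewrite (Cmod_minus_sym l (csum a (n + N))) in H.
  pose proof (half_pow_pos n). pose proof (half_pow_pos N).
  assert (0 <= 2 * M * (1 / 2) ^ n * (1/2)^N)
    by (repeat apply Rmult_le_pos; lra).
  lra.
Qed.

Lemma geometric_series (a : nat -> C) (M : R) :
  (forall n, Cmod (a n) <= M * (1/2)^n) ->
  exists l, is_Cseries a l.
Proof.
  intros Ha.
  apply (ex_series_le (K := C_AbsRing) (V := C_CompleteNormedModule) a
           (fun n => M * (1/2)^n)).
  - intros n. exact (Ha n).
  - exists (M * (/ (1 - 1/2))).
    apply (is_series_scal_l (K := R_AbsRing) (V := R_NormedModule) M).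
    apply is_series_geom. rewrite Rabs_right; lra.
Qed.

Lemma linear_geometric_lim (M : R) :
  is_lim_seq (fun n => M * (INR n + 1) * (1/2)^n) 0.
Proof.
  (* By Bernoulli's inequality n + 1 <= 2 (3/2)^n. *)
  assert (HB : forall n, (INR n + 1) * (1/2)^n <= 2 * (3/4)^n).
  { intros n. replace (3/4) with (3/2 * (1/2)) by lra. rewrite Rpow_mult_distr.
    rewrite <- Rmult_assoc. apply Rmult_le_compat_r; [left; apply half_pow_pos|].
    pose proof (poly n (1/2) ltac:(lra)).
    replace (3/2) with (1 + 1/2) by lra. lra. }
  assert (H : is_lim_seq (fun n => (INR n + 1) * (1/2)^n) 0).
  { apply (is_lim_seq_le_le (fun _ => 0) _ (fun n => 2 * (3/4)^n)).
    - intros n. split; [|apply HB]. apply Rmult_le_pos.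
      + pose proof (pos_INR n). lra.
      + left. apply half_pow_pos.
    - apply is_lim_seq_const.
    - replace 0 with (2 * 0) by lra. apply (is_lim_seq_scal_l _ 2 0).
      apply is_lim_seq_geom. rewrite Rabs_right; lra. }
  apply (is_lim_seq_ext (fun n => M * ((INR n + 1) * (1/2)^n))).
  - intros n. ring.
  - replace 0 with (M * 0) by ring. exact (is_lim_seq_scal_l _ M 0 H).
Qed.

(** Both sides sum [T p n] over the triangle [p + n < N]. *)
Lemma csum_triangle (T : nat -> nat -> C) (N : nat) :
  csum (fun n => csum (fun p => T p (n - p)%nat) (S n)) N
  = csum (fun p => csum (T p) (N - p)) N.
Proof.
  induction N as [|N IH]; [reflexivity|].
  change (csum (fun n => csum (fun p => T p (n - p)%nat) (S n)) (S N))
    with (csum (fun n => csum (fun p => T p (n - p)%nat) (S n)) N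
          + csum (fun p => T p (N - p)%nat) (S N))%C.
  rewrite IH.
  change (csum (fun p => csum (T p) (S N - p)) (S N))
    with (csum (fun p => csum (T p) (S N - p)) N + csum (T N) (S N - N))%C.
  rewrite (csum_ext (fun p => csum (T p) (S N - p))
             (fun p => csum (T p) (N - p) + T p (N - p)%nat)%C).
  - rewrite csum_plus. replace (S N - N)%nat with 1%nat by lia. simpl.
    rewrite Nat.sub_diag. ring.
  - intros k Hk. replace (S N - k)%nat with (S (N - k)) by lia. reflexivity.
Qed.

(** The partial sum over the triangle [p + n < N] misses the partial sum of the
    [r p] by at most [N] row tails, each of size [O(2 ^ -N)]; so summing by rows and
    summing along the diagonals [p + n = N] give the same value. *)
Lemma double_series_diagonal (T : nat -> nat -> C) (r : nat -> C) (M : R) :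
  (forall p n, Cmod (T p n) <= M * (1/2)^p * (1/2)^n) ->
  (forall p, is_Cseries (T p) (r p)) ->
  exists s,
    is_Cseries r s /\
    is_Cseries
      (fun N => csum (fun p => T p (N - p)%nat) (S N)) s.
Proof.
  intros HT Hr.
  assert (Htail : forall p n,
      Cmod (r p - csum (T p) n) <= 2 * M * (1/2)^p * (1/2)^n).
  { intros p n.
    pose proof (geometric_tail (T p) (r p) (M * (1/2)^p) (HT p) (Hr p) n). lra. }
  assert (Hrp : forall p, Cmod (r p) <= 2 * M * (1/2)^p).
  { intros p. specialize (Htail p O). simpl in Htail.
    replace (r p - 0)%C with (r p) in Htail by ring. lra. }
  destruct (geometric_series r (2 * M) Hrp) as [s Hs].
  exists s. split; [exact Hs|].
  apply (is_series_squeeze _ _ (fun n => 4 * M * (INR n + 1) * (1/2)^n));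
    [|apply linear_geometric_lim].
  intros N. rewrite csum_triangle.
  eapply Rle_trans; [apply (Cmod_triangle_minus _ (csum r N))|].
  assert (H1 : Cmod (csum r N - s) <= 4 * M * (1/2)^N).
  { rewrite Cmod_minus_sym. pose proof (geometric_tail r s _ Hrp Hs N). lra. }
  assert (H2 : Cmod (csum (fun p => csum (T p) (N - p)) N - csum r N)
               <= INR N * (2 * M * (1/2)^N)).
  { replace (csum (fun p => csum (T p) (N - p)) N - csum r N)%C
      with (csum (fun p => csum (T p) (N - p) + (-1) * r p)%C N)
      by (rewrite csum_plus, csum_scal; ring).
    apply Cmod_csum_le. intros k Hk.
    replace (csum (T k) (N - k) + (-1) * r k)%C
      with (csum (T k) (N - k) - r k)%C by ring.
    rewrite Cmod_minus_sym.
    eapply Rle_trans; [apply Htail|].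
    rewrite Rmult_assoc, <- pow_add. replace (k + (N - k))%nat with N by lia. lra. }
  pose proof (half_pow_pos N).
  assert (HM : 0 <= M).
  { specialize (HT O O). simpl in HT. pose proof (Cmod_ge_0 (T O O)). lra. }
  assert (0 <= M * (INR N * (1/2)^N)) by
    (apply Rmult_le_pos; [lra|]; apply Rmult_le_pos; [apply pos_INR|lra]).
  lra.
Qed.

Lemma is_Cseries_ext (a b : nat -> C) (l : C) :
  (forall n, a n = b n) -> is_Cseries a l -> is_Cseries b l.
Proof. apply is_series_ext. Qed.

Lemma is_Cseries_plus (a b : nat -> C) (la lb : C) :
  is_Cseries a la -> is_Cseries b lb -> is_Cseries (fun n => a n + b n)%C (la + lb)%C.
Proof. exact (is_series_plus a b la lb). Qed.

Lemma is_Cseries_scal (c : C) (a : nat -> C) (l : C) :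
  is_Cseries a l -> is_Cseries (fun n => c * a n)%C (c * l)%C.
Proof. exact (is_series_scal_l (K := C_AbsRing) (V := C_NormedModule) c a l). Qed.

Lemma is_Cseries_shift (a : nat -> C) (l : C) (m : nat) :
  is_Cseries a l -> is_Cseries (fun k => a (m + k)%nat) (l - csum a m)%C.
Proof.
  intros H. destruct m as [|m].
  - apply (is_Cseries_ext a); [reflexivity|]. simpl.
    replace (l - 0)%C with l by ring. exact H.
  - apply (is_series_incr_n (K := C_AbsRing) (V := C_NormedModule) a (S m)); [lia|].
    simpl Init.Nat.pred. rewrite csum_sum_n.
    change (plus (l - csum a (S m))%C (csum a (S m))) with (l - csum a (S m) + csum a (S m))%C.
    replace (l - csum a (S m) + csum a (S m))%C with l by ring. exact H.
Qed.

Lemma is_Cseries_single (v : C) :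
  is_Cseries (fun n => match n with O => v | S _ => RtoC 0 end) v.
Proof.
  apply (is_series_squeeze _ _ (fun n => Cmod v * (INR n + 1) * (1/2)^n));
    [intros [|n]|apply linear_geometric_lim].
  - cbn [csum]. replace (0 - v)%C with (- v)%C by ring. rewrite Cmod_opp. simpl. lra.
  - rewrite csum_shift, csum_zero by reflexivity.
    replace (v + 0 - v)%C with (RtoC 0) by ring. rewrite Cmod_0.
    pose proof (pos_INR (S n)).
    apply Rmult_le_pos; [apply Rmult_le_pos; [apply Cmod_ge_0|lra]|left; apply half_pow_pos].
Qed.

Lemma is_series_from_shift (m : nat) (a : nat -> C) (s : C) :
  (forall k, (k < m)%nat -> a k = RtoC 0) -> is_Cseries a s -> is_series_from m a s.
Proof.
  intros H Hs. apply (is_Cseries_shift _ _ m) in Hs. rewrite csum_zero in Hs by exact H.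
  replace (s - 0)%C with s in Hs by ring. exact Hs.
Qed.

(** * Bisection of rectangles and compact squares *)

Lemma nested_intervals (lo hi : nat -> R) :
  (forall n, lo n <= lo (S n)) -> (forall n, hi (S n) <= hi n) ->
  (forall n, lo n <= hi n) ->
  exists u, forall n, lo n <= u <= hi n.
Proof.
  intros Hlo Hhi Hle.
  assert (Hlo' : forall n k, lo n <= lo (n + k)%nat).
  { intros n k. induction k as [|k IH]; [rewrite Nat.add_0_r; lra|].
    rewrite Nat.add_succ_r. specialize (Hlo (n + k)%nat). lra. }
  assert (Hhi' : forall n k, hi (n + k)%nat <= hi n).
  { intros n k. induction k as [|k IH]; [rewrite Nat.add_0_r; lra|].
    rewrite Nat.add_succ_r. specialize (Hhi (n + k)%nat). lra. }
  assert (Hcross : forall n m, lo n <= hi m).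
  { intros n m. specialize (Hlo' n m). specialize (Hhi' m n).
    rewrite Nat.add_comm in Hhi'. specialize (Hle (n + m)%nat). lra. }
  destruct (completeness (fun x => exists n, x = lo n)) as [u [Hub Hlub]].
  - exists (hi O). intros x [n ->]. apply Hcross.
  - exists (lo O), O. reflexivity.
  - exists u. intros n. split.
    + apply Hub. exists n. reflexivity.
    + apply Hlub. intros x [m ->]. apply Hcross.
Qed.

(** If [P a b c d] failed, some quarter of the rectangle would fail as well, and
    iterating would produce nested failing rectangles that shrink to a point.  The
    small rectangles in the local hypothesis contain the point [(u, v)]; Goursat's
    lemma needs this, since differentiability at [(u, v)] only controls increments
    from that point. *)
Lemma rectangle_bisection (P : R -> R -> R -> R -> Prop) (a b c d : R) :
  a <= b -> c <= d ->
  (forall s1 s2 t1 t2, s1 <= s2 -> t1 <= t2 ->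
     P s1 ((s1 + s2) / 2) t1 ((t1 + t2) / 2) ->
     P ((s1 + s2) / 2) s2 t1 ((t1 + t2) / 2) ->
     P s1 ((s1 + s2) / 2) ((t1 + t2) / 2) t2 ->
     P ((s1 + s2) / 2) s2 ((t1 + t2) / 2) t2 ->
     P s1 s2 t1 t2) ->
  (forall u v, a <= u <= b -> c <= v <= d ->
     exists delta, 0 < delta /\
       forall s1 s2 t1 t2, s1 <= u <= s2 -> t1 <= v <= t2 ->
         s2 - s1 < delta -> t2 - t1 < delta -> P s1 s2 t1 t2) ->
  P a b c d.
Proof.
  intros Hab Hcd Hsplit Hlocal.
  apply NNPP. intros Hbad0.
  set (B := fun q : (R * R) * (R * R) =>
    ~ P (fst (fst q)) (snd (fst q)) (fst (snd q)) (snd (snd q))).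
  set (V := fun q : (R * R) * (R * R) =>
    fst (fst q) <= snd (fst q) /\ fst (snd q) <= snd (snd q)).
  set (H := fun i j : R * R =>
     snd j - fst j = (snd i - fst i) / 2 /\ fst i <= fst j /\ snd j <= snd i).
  assert (Hstep : forall q, exists q', V q -> B q ->
             V q' /\ B q' /\ H (fst q) (fst q') /\ H (snd q) (snd q')).
  { intros [[s1 s2] [t1 t2]].
    destruct (classic (B ((s1, (s1 + s2) / 2), (t1, (t1 + t2) / 2)))) as [H1|H1].
    { exists ((s1, (s1 + s2) / 2), (t1, (t1 + t2) / 2)).
      unfold V, H; simpl; intros [? ?] ?. repeat split; auto; lra. }
    destruct (classic (B (((s1 + s2) / 2, s2), (t1, (t1 + t2) / 2)))) as [H2|H2].
    { exists (((s1 + s2) / 2, s2), (t1, (t1 + t2) / 2)).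
      unfold V, H; simpl; intros [? ?] ?. repeat split; auto; lra. }
    destruct (classic (B ((s1, (s1 + s2) / 2), ((t1 + t2) / 2, t2)))) as [H3|H3].
    { exists ((s1, (s1 + s2) / 2), ((t1 + t2) / 2, t2)).
      unfold V, H; simpl; intros [? ?] ?. repeat split; auto; lra. }
    exists (((s1 + s2) / 2, s2), ((t1 + t2) / 2, t2)).
    unfold V; simpl; intros [? ?] HB.
    split; [lra|]. split; [|unfold H; simpl; repeat split; lra].
    intros HP4. apply HB. simpl.
    apply Hsplit; auto; [apply NNPP, H1|apply NNPP, H2|apply NNPP, H3]. }
  destruct (choice _ Hstep) as [step Hs].
  set (q := fix q n := match n with O => ((a, b), (c, d)) | S k => step (q k) end).
  assert (Hq : forall n, V (q n) /\ B (q n)).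
  { induction n as [|n [IHV IHB]].
    - split; [split; simpl; lra|exact Hbad0].
    - destruct (Hs (q n) IHV IHB) as (? & ? & _). split; assumption. }
  assert (HH : forall n, H (fst (q n)) (fst (q (S n))) /\ H (snd (q n)) (snd (q (S n)))).
  { intros n. destruct (Hq n) as [HV HB]. destruct (Hs (q n) HV HB) as (_ & _ & ? & ?).
    split; assumption. }
  assert (Hlen : forall n,
     snd (fst (q n)) - fst (fst (q n)) = (b - a) * (1/2)^n /\
     snd (snd (q n)) - fst (snd (q n)) = (d - c) * (1/2)^n).
  { induction n as [|n [IH1 IH2]]; [simpl; lra|].
    destruct (HH n) as [[L1 _] [L2 _]]. rewrite L1, L2, IH1, IH2. simpl pow. lra. }
  destruct (nested_intervals (fun n => fst (fst (q n))) (fun n => snd (fst (q n))))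
    as [u Hu].
  1-3: intros n; destruct (HH n) as [(_ & ? & ?) _], (Hq n) as [[? _] _]; lra.
  destruct (nested_intervals (fun n => fst (snd (q n))) (fun n => snd (snd (q n))))
    as [v Hv].
  1-3: intros n; destruct (HH n) as [_ (_ & ? & ?)], (Hq n) as [[_ ?] _]; lra.
  destruct (Hlocal u v (Hu O) (Hv O)) as [delta [Hd HP]].
  assert (Hlim : is_lim_seq (fun n => (b - a + (d - c)) * (1/2)^n) 0).
  { replace 0 with ((b - a + (d - c)) * 0) by ring.
    apply (is_lim_seq_scal_l _ _ 0). apply is_lim_seq_geom.
    rewrite Rabs_right; lra. }
  apply is_lim_seq_spec in Hlim. destruct (Hlim (mkposreal delta Hd)) as [N HN].
  specialize (HN N (le_n N)). simpl in HN. rewrite Rminus_0_r in HN.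
  apply Rabs_def2 in HN. destruct HN as [HN _].
  destruct (Hq N) as [_ HB]. apply HB.
  destruct (Hlen N) as [L1 L2]. pose proof (half_pow_pos N).
  assert (0 <= (b - a) * (1/2)^N) by (apply Rmult_le_pos; lra).
  assert (0 <= (d - c) * (1/2)^N) by (apply Rmult_le_pos; lra).
  apply HP; [apply Hu|apply Hv|rewrite L1; lra|rewrite L2; lra].
Qed.

(** The neighbourhood of the main theorem is a square rather than a disc because
    its compactness is then immediate by bisection. *)
Definition square (r : R) (z : C) : Prop := Rabs (Re z) <= r /\ Rabs (Im z) <= r.

(** A rectangle without finite subcover has a quarter without finite subcover, but
    a small rectangle around any point lies in a single member of the cover. *)
Lemma square_compact (r : R) : 0 <= r -> compact_set (square r).
Proof.
  intros Hr F HF Hcov.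
  set (P := fun s1 s2 t1 t2 : R =>
    exists l : list (C -> Prop), (forall U, In U l -> F U) /\
      forall x : C, s1 <= Re x <= s2 -> t1 <= Im x <= t2 ->
        exists U, In U l /\ U x).
  assert (HP : P (-r) r (-r) r).
  { apply rectangle_bisection; try lra.
    - intros s1 s2 t1 t2 _ _ [l1 [F1 C1]] [l2 [F2 C2]] [l3 [F3 C3]] [l4 [F4 C4]].
      exists (l1 ++ l2 ++ l3 ++ l4). split.
      + intros U HU. rewrite !in_app_iff in HU.
        destruct HU as [?|[?|[?|?]]]; auto.
      + intros x Hx Hy.
        destruct (Rle_dec (Re x) ((s1 + s2) / 2)), (Rle_dec (Im x) ((t1 + t2) / 2)).
        * destruct (C1 x) as [U [? ?]]; try lra. exists U. rewrite !in_app_iff. tauto.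
        * destruct (C3 x) as [U [? ?]]; try lra. exists U. rewrite !in_app_iff. tauto.
        * destruct (C2 x) as [U [? ?]]; try lra. exists U. rewrite !in_app_iff. tauto.
        * destruct (C4 x) as [U [? ?]]; try lra. exists U. rewrite !in_app_iff. tauto.
    - intros u v Hu Hv.
      destruct (Hcov (u, v)) as [U [FU Uuv]].
      { split; simpl; apply Rabs_le; lra. }
      destruct (HF U FU (u, v) Uuv) as [[delta Hd] HU].
      exists delta. split; [exact Hd|].
      intros s1 s2 t1 t2 Hs Ht Hsd Htd. exists (U :: nil). split.
      + intros W [<-|[]]. exact FU.
      + intros x Hx Hy. exists U. split; [left; reflexivity|].
        apply HU. split; simpl.
        * change (Rabs (Re x - u) < delta). apply Rabs_def1; lra.
        * change (Rabs (Im x - v) < delta). apply Rabs_def1; lra. }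
  destruct HP as [l [Hl Hc]]. exists l. split; [exact Hl|].
  intros x [H1 H2]. apply Rabs_le_between in H1, H2. apply Hc; lra.
Qed.

Lemma square_symmetric (r : R) : symmetric_set (square r).
Proof.
  intros x [H1 H2]. split; simpl.
  - rewrite Rabs_Ropp. exact H1.
  - rewrite Rabs_Ropp. exact H2.
Qed.

Lemma square_convex (r : R) : convex_set (square r).
Proof.
  intros x y t [Hx1 Hx2] [Hy1 Hy2] Ht.
  apply Rabs_le_between in Hx1, Hx2, Hy1, Hy2.
  unfold Re, Im in *. split; simpl; apply Rabs_le; nra.
Qed.

Lemma square_neighbourhood (r : R) : 0 < r -> locally (RtoC 0) (square r).
Proof.
  intros Hr. exists (mkposreal r Hr). intros z [H1 H2].
  change (Rabs (Re z - 0) < r) in H1. change (Rabs (Im z - 0) < r) in H2.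
  rewrite Rminus_0_r in H1, H2. split; lra.
Qed.

Lemma square_Cmod (r : R) (z : C) : square r z -> Cmod z <= 2 * r.
Proof.
  intros [H1 H2].
  replace z with (RtoC (Re z) + Ci * RtoC (Im z))%C.
  - eapply Rle_trans; [apply Cmod_triangle|].
    rewrite Cmod_mult, Cmod_Ci, !Cmod_R. lra.
  - destruct z as [x y]. unfold Cplus, Cmult, RtoC, Ci. simpl. f_equal; ring.
Qed.

(** * Complex derivatives, and integrals of paths in the plane *)

(** The plane carries several uniform structures with different balls; the
    epsilon-delta form with the modulus avoids moving between them. *)
Lemma is_derive_C_eps (f : C -> C) (z l : C) :
  is_Cderive f z l <->
  forall eps, 0 < eps -> exists delta, 0 < delta /\
    forall w, Cmod (w - z) < delta ->
      Cmod (f w - f z - (w - z) * l) <= eps * Cmod (w - z).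
Proof.
  split.
  - intros [_ H] eps He.
    specialize (H z (fun P HP => HP) (mkposreal eps He)).
    destruct H as [[delta Hd] H]. exists delta. split; [exact Hd|].
    intros w Hw. exact (H w Hw).
  - intros H. split; [apply is_linear_scal_l|].
    intros x Hx.
    assert (Hxz : z = x).
    { exact (is_filter_lim_locally_unique (K := C_AbsRing)
        (V := AbsRing_NormedModule C_AbsRing) z x Hx). }
    subst x. intros [eps He]. destruct (H eps He) as [delta [Hd Hw]].
    exists (mkposreal delta Hd). intros w Hball. exact (Hw w Hball).
Qed.

Definition path_cont (h : R -> C) : Prop :=
  forall t, continuous (U := C_R_NormedModule) h t.

Lemma path_cont_eps (h : R -> C) :
  (forall t eps, 0 < eps -> exists delta, 0 < delta /\
     forall x, Rabs (x - t) < delta -> Cmod (h x - h t) < eps) -> path_cont h.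
Proof.
  intros H t.
  apply (filterlim_locally_ball_norm (K := R_AbsRing) (U := C_R_NormedModule)).
  intros [eps He]. destruct (H t eps He) as [delta [Hd Hx]].
  exists (mkposreal delta Hd). intros x Hball. unfold ball_norm.
  rewrite <- Cmod_norm. exact (Hx x Hball).
Qed.

Lemma path_cont_elim (h : R -> C) (t eps : R) : path_cont h -> 0 < eps ->
  exists delta, 0 < delta /\
     forall x, Rabs (x - t) < delta -> Cmod (h x - h t) < eps.
Proof.
  intros H He.
  pose proof (proj1 (filterlim_locally_ball_norm (K := R_AbsRing) (U := C_R_NormedModule) _ _) (H t)) as H'.
  destruct (H' (mkposreal eps He)) as [[delta Hd] Hx].
  exists delta. split; [exact Hd|]. intros x Hxt. specialize (Hx x Hxt).
  unfold ball_norm in Hx. rewrite <- Cmod_norm in Hx. exact Hx.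
Qed.

Lemma path_cont_plus (g h : R -> C) : path_cont g -> path_cont h ->
  path_cont (fun t => g t + h t)%C.
Proof.
  intros Hg Hh t. exact (continuous_plus (V := C_R_NormedModule) g h t (Hg t) (Hh t)).
Qed.

Lemma path_cont_const (c : C) : path_cont (fun _ => c).
Proof. intros t. apply continuous_const. Qed.

Lemma path_cont_mult (g h : R -> C) : path_cont g -> path_cont h ->
  path_cont (fun t => g t * h t)%C.
Proof.
  intros Hg Hh. apply path_cont_eps. intros t eps He.
  set (A := Cmod (g t)). set (B := Cmod (h t)).
  assert (HA : 0 <= A) by apply Cmod_ge_0.
  assert (HB : 0 <= B) by apply Cmod_ge_0.
  set (e := Rmin 1 (eps / (A + B + 2))).
  assert (Hq : 0 < eps / (A + B + 2)) by (apply Rdiv_lt_0_compat; lra).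
  assert (He' : 0 < e) by (apply Rmin_pos; lra).
  assert (e1 : e <= 1) by apply Rmin_l.
  assert (e2 : e * (A + B + 2) <= eps).
  { apply Rle_trans with (eps / (A + B + 2) * (A + B + 2)).
    - apply Rmult_le_compat_r; [lra|apply Rmin_r].
    - right. field. lra. }
  destruct (path_cont_elim g t e Hg He') as [d1 [Hd1 H1]].
  destruct (path_cont_elim h t e Hh He') as [d2 [Hd2 H2]].
  exists (Rmin d1 d2). split; [apply Rmin_pos; lra|].
  intros x Hx.
  assert (Hx1 := Rlt_le_trans _ _ _ Hx (Rmin_l _ _)).
  assert (Hx2 := Rlt_le_trans _ _ _ Hx (Rmin_r _ _)).
  specialize (H1 x Hx1). specialize (H2 x Hx2).
  replace (g x * h x - g t * h t)%C
    with ((g x - g t) * (h x - h t) + ((g x - g t) * h t + g t * (h x - h t)))%C by ring.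
  eapply Rle_lt_trans; [apply Cmod_triangle|].
  eapply Rle_lt_trans; [apply Rplus_le_compat_l, Cmod_triangle|].
  rewrite !Cmod_mult. fold A B.
  pose proof (Cmod_ge_0 (g x - g t)). pose proof (Cmod_ge_0 (h x - h t)).
  nra.
Qed.

Definition CInt (h : R -> C) (a b : R) : C :=
  RInt (V := C_R_CompleteNormedModule) h a b.

Lemma path_cont_is_RInt (h : R -> C) (a b : R) : path_cont h ->
  is_RInt (V := C_R_NormedModule) h a b (CInt h a b).
Proof.
  intros H. apply (RInt_correct (V := C_R_CompleteNormedModule)).
  apply (ex_RInt_continuous (V := C_R_CompleteNormedModule)). intros z _. apply H.
Qed.

Lemma CInt_unique (h : R -> C) (a b : R) (l : C) :
  is_RInt (V := C_R_NormedModule) h a b l -> CInt h a b = l.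
Proof. exact (is_RInt_unique (V := C_R_CompleteNormedModule) h a b l). Qed.

Lemma CInt_ext (g h : R -> C) (a b : R) :
  (forall t, g t = h t) -> CInt g a b = CInt h a b.
Proof. intros H. apply (RInt_ext (V := C_R_CompleteNormedModule)). intros x _. apply H. Qed.

Lemma CInt_plus (g h : R -> C) (a b : R) : path_cont g -> path_cont h ->
  CInt (fun t => g t + h t)%C a b = (CInt g a b + CInt h a b)%C.
Proof.
  intros Hg Hh. apply CInt_unique.
  exact (is_RInt_plus (V := C_R_NormedModule) g h a b _ _
    (path_cont_is_RInt g a b Hg) (path_cont_is_RInt h a b Hh)).
Qed.

Lemma CInt_Chasles (h : R -> C) (a b c : R) : path_cont h ->
  CInt h a c = (CInt h a b + CInt h b c)%C.
Proof.
  intros Hh. apply CInt_unique.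
  exact (is_RInt_Chasles (V := C_R_NormedModule) h a b c _ _
    (path_cont_is_RInt h a b Hh) (path_cont_is_RInt h b c Hh)).
Qed.

(** The integral is defined through the real vector space structure, so
    linearity for complex scalars is checked on coordinates. *)
Lemma CInt_scal (c : C) (h : R -> C) (a b : R) : path_cont h ->
  CInt (fun t => c * h t)%C a b = (c * CInt h a b)%C.
Proof.
  intros Hh. apply CInt_unique.
  pose proof (path_cont_is_RInt h a b Hh) as H.
  pose proof (is_RInt_fct_extend_fst _ _ _ _ H) as H1.
  pose proof (is_RInt_fct_extend_snd _ _ _ _ H) as H2.
  apply (is_RInt_fct_extend_pair (U := R_NormedModule) (V := R_NormedModule)).
  - apply (is_RInt_minus (V := R_NormedModule) (fun t => fst c * fst (h t))
      (fun t => snd c * snd (h t))).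
    + exact (is_RInt_scal (V := R_NormedModule) _ _ _ (fst c) _ H1).
    + exact (is_RInt_scal (V := R_NormedModule) _ _ _ (snd c) _ H2).
  - apply (is_RInt_plus (V := R_NormedModule) (fun t => fst c * snd (h t))
      (fun t => snd c * fst (h t))).
    + exact (is_RInt_scal (V := R_NormedModule) _ _ _ (fst c) _ H2).
    + exact (is_RInt_scal (V := R_NormedModule) _ _ _ (snd c) _ H1).
Qed.

Lemma CInt_const (c : C) (a b : R) : CInt (fun _ => c) a b = (RtoC (b - a) * c)%C.
Proof.
  rewrite <- scal_R_Cmult. exact (RInt_const (V := C_R_CompleteNormedModule) a b c).
Qed.

Lemma CInt_le (h : R -> C) (a b M : R) : path_cont h -> a <= b ->
  (forall t, a <= t <= b -> Cmod (h t) <= M) -> Cmod (CInt h a b) <= (b - a) * M.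
Proof.
  intros Hh Hab HM.
  rewrite Cmod_norm.
  apply (norm_RInt_le_const (V := C_R_NormedModule) h a b); auto.
  - intros t Ht. rewrite <- Cmod_norm. exact (HM t Ht).
  - exact (path_cont_is_RInt h a b Hh).
Qed.

Lemma path_cont_RtoC (g : R -> R) : (forall t, continuous g t) -> path_cont (fun t => RtoC (g t)).
Proof.
  intros Hg. apply path_cont_eps. intros t eps He.
  pose proof (proj1 (filterlim_locally_ball_norm (K := R_AbsRing) (U := R_NormedModule) _ _) (Hg t)) as H'.
  destruct (H' (mkposreal eps He)) as [[delta Hd] Hx].
  exists delta. split; [exact Hd|]. intros x Hxt. rewrite <- RtoC_minus, Cmod_R.
  exact (Hx x Hxt).
Qed.

Lemma continuous_exp_at (t : R) : continuous exp t.
Proof.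
  apply (ex_derive_continuous (K := R_AbsRing) (V := R_NormedModule) exp t).
  exists (exp t). apply is_derive_exp.
Qed.

Lemma path_cont_exp : path_cont (fun t => RtoC (exp t)).
Proof. apply path_cont_RtoC, continuous_exp_at. Qed.

Lemma CInt_exp (a b : R) : CInt (fun s => RtoC (exp s)) a b = RtoC (exp b - exp a).
Proof.
  apply CInt_unique.
  apply (is_RInt_fct_extend_pair (U := R_NormedModule) (V := R_NormedModule)); simpl.
  - apply (is_RInt_derive (V := R_CompleteNormedModule) exp exp).
    + intros x _. apply is_derive_exp.
    + intros x _. apply continuous_exp_at.
  - pose proof (is_RInt_const (V := R_NormedModule) a b 0) as H.
    change (scal (b - a) 0) with ((b - a) * 0) in H. rewrite Rmult_0_r in H. exact H.
Qed.

(** * Goursat's lemma in logarithmic polar coordinates *)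

Definition C_continuous (f : C -> C) : Prop :=
  forall z eps, 0 < eps -> exists delta, 0 < delta /\
    forall w, Cmod (w - z) < delta -> Cmod (f w - f z) < eps.

Lemma entire_continuous (f : C -> C) : entire f -> C_continuous f.
Proof.
  intros Hf z eps He. destruct (Hf z) as [l Hl].
  rewrite is_derive_C_eps in Hl. destruct (Hl 1 Rlt_0_1) as [d [Hd H]].
  pose proof (Cmod_ge_0 l).
  assert (Hq : 0 < eps / (2 + Cmod l)) by (apply Rdiv_lt_0_compat; lra).
  exists (Rmin d (eps / (2 + Cmod l))). split; [apply Rmin_pos; lra|].
  intros w Hw.
  assert (Hw1 := Rlt_le_trans _ _ _ Hw (Rmin_l _ _)).
  assert (Hw2 := Rlt_le_trans _ _ _ Hw (Rmin_r _ _)).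
  specialize (H w Hw1).
  replace (f w - f z)%C with ((f w - f z - (w - z) * l) + (w - z) * l)%C by ring.
  eapply Rle_lt_trans; [apply Cmod_triangle|]. rewrite Cmod_mult.
  apply Rle_lt_trans with (Cmod (w - z) * (1 + Cmod l)); [nra|].
  apply Rle_lt_trans with (eps / (2 + Cmod l) * (1 + Cmod l)).
  - apply Rmult_le_compat_r; lra.
  - apply Rlt_le_trans with (eps / (2 + Cmod l) * (2 + Cmod l)).
    + apply Rmult_lt_compat_l; lra.
    + right. field. lra.
Qed.

Lemma C_continuous_ext (f g : C -> C) : (forall z, f z = g z) -> C_continuous f -> C_continuous g.
Proof.
  intros E H z eps He. destruct (H z eps He) as [d [Hd Hw]].
  exists d. split; [exact Hd|]. intros w. rewrite <- !E. apply Hw.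
Qed.

Lemma C_continuous_plus (f g : C -> C) : C_continuous f -> C_continuous g ->
  C_continuous (fun z => f z + g z)%C.
Proof.
  intros Hf Hg z eps He.
  destruct (Hf z (eps / 2)) as [d1 [Hd1 H1]]; [lra|].
  destruct (Hg z (eps / 2)) as [d2 [Hd2 H2]]; [lra|].
  exists (Rmin d1 d2). split; [apply Rmin_pos; lra|]. intros w Hw.
  specialize (H1 w (Rlt_le_trans _ _ _ Hw (Rmin_l _ _))).
  specialize (H2 w (Rlt_le_trans _ _ _ Hw (Rmin_r _ _))).
  replace (f w + g w - (f z + g z))%C with ((f w - f z) + (g w - g z))%C by ring.
  eapply Rle_lt_trans; [apply Cmod_triangle|]. lra.
Qed.

Lemma C_continuous_affine (al be a : C) : C_continuous (fun z => al + be * (z - a))%C.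
Proof.
  intros z eps He. pose proof (Cmod_ge_0 be).
  exists (eps / (1 + Cmod be)). split; [apply Rdiv_lt_0_compat; lra|].
  intros w Hw.
  replace (al + be * (w - a) - (al + be * (z - a)))%C with (be * (w - z))%C by ring.
  rewrite Cmod_mult.
  apply Rle_lt_trans with (Cmod be * (eps / (1 + Cmod be))).
  - apply Rmult_le_compat_l; lra.
  - apply Rlt_le_trans with ((1 + Cmod be) * (eps / (1 + Cmod be))).
    + apply Rmult_lt_compat_r; [apply Rdiv_lt_0_compat|]; lra.
    + right. field. lra.
Qed.

Lemma path_cont_comp (f : C -> C) (h : R -> C) : C_continuous f -> path_cont h ->
  path_cont (fun t => f (h t)).
Proof.
  intros Hf Hh. apply path_cont_eps. intros t eps He.
  destruct (Hf (h t) eps He) as [d [Hd H]].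
  destruct (path_cont_elim h t d Hh Hd) as [d' [Hd' H']].
  exists d'. split; [exact Hd'|]. intros x Hx. apply H, H', Hx.
Qed.

(** [k] is the logarithmic derivative of the path [u]: the clause [ld_int] says
    [u' = u k] in integrated form, the only form in which it is used. *)
Record log_derivative (u k : R -> C) (U kap : R) : Prop := {
  ld_cont_u : path_cont u;
  ld_cont_k : path_cont k;
  ld_int : forall t1 t2, CInt (fun t => u t * k t)%C t1 t2 = (u t2 - u t1)%C;
  ld_bound_u : forall t, Cmod (u t) <= U;
  ld_bound_k : forall t, Cmod (k t) <= kap }.

(** Logarithmic polar coordinates around [a], where the path [a + u] plays the part
    of the unit circle.  In them [dz / (z - a) = ds + k(t) dt], so that
    [f(z) dz / (z - a)] becomes the form [f ds + f k dt], whose integrals along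
    coordinate segments are [ray] and [arc] and whose integral around a coordinate
    rectangle is [loop]. *)
Definition zoom (a : C) (u : R -> C) (s t : R) : C := (a + RtoC (exp s) * u t)%C.

Definition ray (f : C -> C) (a : C) (u : R -> C) (t s1 s2 : R) : C :=
  CInt (fun s => f (zoom a u s t)) s1 s2.

Definition arc (f : C -> C) (a : C) (u k : R -> C) (s t1 t2 : R) : C :=
  CInt (fun t => f (zoom a u s t) * k t)%C t1 t2.

Definition loop (f : C -> C) (a : C) (u k : R -> C) (s1 s2 t1 t2 : R) : C :=
  (ray f a u t1 s1 s2 + arc f a u k s2 t1 t2
   - ray f a u t2 s1 s2 - arc f a u k s1 t1 t2)%C.

Lemma path_cont_zoom_s (f : C -> C) (a : C) (u : R -> C) (t : R) :
  C_continuous f -> path_cont (fun s => f (zoom a u s t)).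
Proof.
  intros Hf. apply path_cont_comp; [exact Hf|]. unfold zoom.
  apply path_cont_plus; [apply path_cont_const|].
  apply path_cont_mult; [apply path_cont_exp|apply path_cont_const].
Qed.

Lemma path_cont_zoom_t (f : C -> C) (a : C) (u k : R -> C) (s : R) :
  C_continuous f -> path_cont u -> path_cont k -> path_cont (fun t => f (zoom a u s t) * k t)%C.
Proof.
  intros Hf Hu Hk. apply path_cont_mult; [|exact Hk].
  apply path_cont_comp; [exact Hf|]. unfold zoom.
  apply path_cont_plus; [apply path_cont_const|].
  apply path_cont_mult; [apply path_cont_const|exact Hu].
Qed.

Lemma loop_ext (f g : C -> C) (a : C) (u k : R -> C) (s1 s2 t1 t2 : R) :
  (forall z, f z = g z) -> loop f a u k s1 s2 t1 t2 = loop g a u k s1 s2 t1 t2.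
Proof.
  intros H.
  assert (HR : forall t, ray f a u t s1 s2 = ray g a u t s1 s2)
    by (intros t; apply CInt_ext; intros s; apply H).
  assert (HA : forall s, arc f a u k s t1 t2 = arc g a u k s t1 t2)
    by (intros s; apply CInt_ext; intros t; rewrite H; reflexivity).
  unfold loop. rewrite !HR, !HA. reflexivity.
Qed.

Lemma loop_split (f : C -> C) (a : C) (u k : R -> C) (s1 s2 s3 t1 t2 t3 : R) :
  C_continuous f -> path_cont u -> path_cont k ->
  loop f a u k s1 s3 t1 t3 =
    (loop f a u k s1 s2 t1 t2 + loop f a u k s2 s3 t1 t2
     + loop f a u k s1 s2 t2 t3 + loop f a u k s2 s3 t2 t3)%C.
Proof.
  intros Hf Hu Hk.
  assert (HR : forall t, ray f a u t s1 s3 = (ray f a u t s1 s2 + ray f a u t s2 s3)%C).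
  { intros t. apply CInt_Chasles, path_cont_zoom_s, Hf. }
  assert (HA : forall s, arc f a u k s t1 t3 = (arc f a u k s t1 t2 + arc f a u k s t2 t3)%C).
  { intros s. apply CInt_Chasles, path_cont_zoom_t; assumption. }
  unfold loop. rewrite !HR, !HA. ring.
Qed.

Lemma loop_plus (g h : C -> C) (a : C) (u k : R -> C) (s1 s2 t1 t2 : R) :
  C_continuous g -> C_continuous h -> path_cont u -> path_cont k ->
  loop (fun z => g z + h z)%C a u k s1 s2 t1 t2 =
    (loop g a u k s1 s2 t1 t2 + loop h a u k s1 s2 t1 t2)%C.
Proof.
  intros Hg Hh Hu Hk.
  assert (HR : forall t, ray (fun z => g z + h z)%C a u t s1 s2
     = (ray g a u t s1 s2 + ray h a u t s1 s2)%C).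
  { intros t. apply CInt_plus; apply path_cont_zoom_s; assumption. }
  assert (HA : forall s, arc (fun z => g z + h z)%C a u k s t1 t2
     = (arc g a u k s t1 t2 + arc h a u k s t1 t2)%C).
  { intros s. unfold arc. rewrite <- CInt_plus by (apply path_cont_zoom_t; assumption).
    apply CInt_ext. intros t. ring. }
  unfold loop. rewrite !HR, !HA. ring.
Qed.

(** For constant [f] opposite sides cancel, since the coefficient of [ds] is
    independent of [t] and that of [dt] is independent of [s]; for [f(z) = z - a] the
    form is the differential of [exp s * u t]. *)
Lemma loop_affine (al be a : C) (u k : R -> C) (U kap s1 s2 t1 t2 : R) :
  log_derivative u k U kap ->
  loop (fun z => al + be * (z - a))%C a u k s1 s2 t1 t2 = RtoC 0.
Proof.
  intros [Hu Hk HI _ _].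
  assert (HR : forall t, ray (fun z => al + be * (z - a))%C a u t s1 s2
     = (RtoC (s2 - s1) * al + be * u t * RtoC (exp s2 - exp s1))%C).
  { intros t. unfold ray. rewrite <- CInt_exp, <- CInt_const.
    rewrite <- CInt_scal by apply path_cont_exp.
    rewrite <- CInt_plus; [|apply path_cont_const|
      apply path_cont_mult; [apply path_cont_const|apply path_cont_exp]].
    apply CInt_ext. intros s. unfold zoom. ring. }
  assert (HA : forall s, arc (fun z => al + be * (z - a))%C a u k s t1 t2
     = (al * CInt k t1 t2 + be * RtoC (exp s) * (u t2 - u t1))%C).
  { intros s. unfold arc. rewrite <- HI.
    rewrite <- !CInt_scal by (try apply path_cont_mult; assumption).
    rewrite <- CInt_plus; [|apply path_cont_mult; [apply path_cont_const|assumption]|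
      apply path_cont_mult; [apply path_cont_const|apply path_cont_mult; assumption]].
    apply CInt_ext. intros t. unfold zoom. ring. }
  unfold loop. rewrite !HR, !HA, !RtoC_minus. ring.
Qed.

Lemma exp_monotone (x y : R) : x <= y -> exp x <= exp y.
Proof. intros [H| ->]; [left; apply exp_increasing, H|apply Rle_refl]. Qed.

Lemma exp_Lipschitz (B x y : R) : x <= B -> y <= B ->
  Rabs (exp x - exp y) <= exp B * Rabs (x - y).
Proof.
  assert (H : forall x y, y <= x -> x <= B -> exp x - exp y <= exp B * (x - y)).
  { intros p q Hqp HpB.
    replace (exp q) with (exp p * exp (q - p)) by (rewrite <- exp_plus; f_equal; ring).
    pose proof (exp_ineq1_le (q - p)). pose proof (exp_pos p).
    assert (exp p <= exp B) by (apply exp_monotone; exact HpB).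
    nra. }
  intros Hx Hy. destruct (Rle_dec y x) as [Hyx|Hyx].
  - pose proof (H x y Hyx Hx).
    assert (exp y <= exp x) by (apply exp_monotone; exact Hyx).
    rewrite !Rabs_right by lra. assumption.
  - assert (Hxy : x <= y) by lra. pose proof (H y x Hxy Hy).
    assert (exp x < exp y) by (apply exp_increasing; lra).
    rewrite !Rabs_left1 by lra. lra.
Qed.

Lemma zoom_Lipschitz (a : C) (u k : R -> C) (U kap B s s' t t' : R) :
  log_derivative u k U kap -> s <= B -> s' <= B ->
  Cmod (zoom a u s t - zoom a u s' t')
    <= exp B * U * (1 + kap) * (Rabs (s - s') + Rabs (t - t')).
Proof.
  intros [Hu Hk HI HU HK] Hs Hs'.
  assert (U0 : 0 <= U) by (eapply Rle_trans; [apply Cmod_ge_0|apply (HU 0)]).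
  assert (K0 : 0 <= kap) by (eapply Rle_trans; [apply Cmod_ge_0|apply (HK 0)]).
  assert (Hinc : forall x y, x <= y -> Cmod (u y - u x) <= (y - x) * (U * kap)).
  { intros x y Hxy. rewrite <- HI. apply CInt_le; [apply path_cont_mult; assumption|exact Hxy|].
    intros r _. rewrite Cmod_mult.
    apply Rmult_le_compat; try apply Cmod_ge_0; [apply HU|apply HK]. }
  assert (Hu' : Cmod (u t - u t') <= Rabs (t - t') * (U * kap)).
  { destruct (Rle_dec t' t).
    - rewrite Rabs_right by lra. apply Hinc; assumption.
    - rewrite Rabs_left1 by lra. rewrite Cmod_minus_sym.
      replace (- (t - t')) with (t' - t) by ring. apply Hinc; lra. }
  unfold zoom.
  replace (a + RtoC (exp s) * u t - (a + RtoC (exp s') * u t'))%C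
    with (RtoC (exp s - exp s') * u t + RtoC (exp s') * (u t - u t'))%C
    by (rewrite RtoC_minus; ring).
  eapply Rle_trans; [apply Cmod_triangle|]. rewrite !Cmod_mult, !Cmod_R.
  rewrite (Rabs_right (exp s')) by (left; apply exp_pos).
  pose proof (exp_Lipschitz B s s' Hs Hs').
  assert (E' : exp s' <= exp B) by (apply exp_monotone; exact Hs').
  pose proof (exp_pos B). pose proof (exp_pos s').
  pose proof (Rabs_pos (s - s')). pose proof (Rabs_pos (t - t')).
  pose proof (Rabs_pos (exp s - exp s')).
  pose proof (Cmod_ge_0 (u t)). pose proof (Cmod_ge_0 (u t - u t')).
  specialize (HU t).
  assert (A1 : Rabs (exp s - exp s') * Cmod (u t) <= exp B * Rabs (s - s') * U)
    by (apply Rmult_le_compat; assumption).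
  assert (A2 : exp s' * Cmod (u t - u t') <= exp B * (Rabs (t - t') * (U * kap)))
    by (apply Rmult_le_compat; lra).
  assert (0 <= exp B * Rabs (s - s') * U * kap) by (repeat apply Rmult_le_pos; lra).
  assert (0 <= exp B * Rabs (t - t') * U) by (repeat apply Rmult_le_pos; lra).
  lra.
Qed.

Lemma loop_le (f : C -> C) (a : C) (u k : R -> C) (U kap M s1 s2 t1 t2 : R) :
  log_derivative u k U kap -> C_continuous f -> s1 <= s2 -> t1 <= t2 ->
  (forall s t, s1 <= s <= s2 -> t1 <= t <= t2 -> Cmod (f (zoom a u s t)) <= M) ->
  Cmod (loop f a u k s1 s2 t1 t2) <= 2 * (1 + kap) * M * ((s2 - s1) + (t2 - t1)).
Proof.
  intros [Hu Hk HI HU HK] Hf Hs Ht HM.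
  assert (K0 : 0 <= kap) by (eapply Rle_trans; [apply Cmod_ge_0|apply (HK 0)]).
  assert (M0 : 0 <= M) by (eapply Rle_trans; [apply Cmod_ge_0|apply (HM s1 t1); lra]).
  assert (HR : forall t, t1 <= t <= t2 -> Cmod (ray f a u t s1 s2) <= (s2 - s1) * M).
  { intros t Ht'. apply CInt_le; [apply path_cont_zoom_s, Hf|exact Hs|].
    intros s Hs'. apply HM; assumption. }
  assert (HA : forall s, s1 <= s <= s2 -> Cmod (arc f a u k s t1 t2) <= (t2 - t1) * (M * kap)).
  { intros s Hs'. apply CInt_le; [apply path_cont_zoom_t; assumption|exact Ht|].
    intros t Ht'. rewrite Cmod_mult.
    apply Rmult_le_compat; try apply Cmod_ge_0; [apply HM; assumption|apply HK]. }
  unfold loop.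
  assert (H1 := HR t1 ltac:(lra)). assert (H2 := HR t2 ltac:(lra)).
  assert (H3 := HA s1 ltac:(lra)). assert (H4 := HA s2 ltac:(lra)).
  unfold Cminus.
  pose proof (Cmod_triangle (ray f a u t1 s1 s2 + arc f a u k s2 t1 t2
     + - ray f a u t2 s1 s2) (- arc f a u k s1 t1 t2)) as T1.
  pose proof (Cmod_triangle (ray f a u t1 s1 s2 + arc f a u k s2 t1 t2)
     (- ray f a u t2 s1 s2)) as T2.
  pose proof (Cmod_triangle (ray f a u t1 s1 s2) (arc f a u k s2 t1 t2)) as T3.
  rewrite Cmod_opp in T1, T2.
  assert (0 <= (s2 - s1) * M * kap) by (repeat apply Rmult_le_pos; lra).
  assert (0 <= (t2 - t1) * M) by (repeat apply Rmult_le_pos; lra).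
  lra.
Qed.

(** Goursat's lemma.  Around a point of the rectangle, [f] is affine up to a
    remainder that is small relative to the distance; the affine part contributes
    nothing, so the integral around a small rectangle is at most [eps] times the
    square of its size.  This bound is inherited from the four quarters of a
    rectangle, because integrals add up while sizes halve. *)
Lemma loop_zero (f : C -> C) (a : C) (u k : R -> C) (U kap s1 s2 t1 t2 : R) :
  log_derivative u k U kap -> entire f -> s1 <= s2 -> t1 <= t2 ->
  loop f a u k s1 s2 t1 t2 = RtoC 0.
Proof.
  intros HL Hf Hs Ht.
  pose proof (entire_continuous f Hf) as Hc.
  assert (Hu := ld_cont_u _ _ _ _ HL). assert (Hk := ld_cont_k _ _ _ _ HL).
  assert (U0 : 0 <= U) by (eapply Rle_trans; [apply Cmod_ge_0|apply (ld_bound_u _ _ _ _ HL 0)]).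
  assert (K0 : 0 <= kap) by (eapply Rle_trans; [apply Cmod_ge_0|apply (ld_bound_k _ _ _ _ HL 0)]).
  (* A Lipschitz constant of [zoom] valid for [s] up to [s2 + 1], so that it covers
     the small rectangles that stick out of the large one. *)
  set (Lam := exp (s2 + 1) * U * (1 + kap) + 1).
  assert (HLam : 1 <= Lam).
  { unfold Lam. pose proof (exp_pos (s2 + 1)).
    assert (0 <= exp (s2 + 1) * U * (1 + kap)) by (repeat apply Rmult_le_pos; lra). lra. }
  set (D := s2 - s1 + (t2 - t1)).
  assert (Heps : forall eps, 0 < eps -> Cmod (loop f a u k s1 s2 t1 t2) <= eps * (D * D)).
  { intros eps He. unfold D.
    apply (rectangle_bisection (fun s1 s2 t1 t2 =>
      Cmod (loop f a u k s1 s2 t1 t2)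
        <= eps * ((s2 - s1 + (t2 - t1)) * (s2 - s1 + (t2 - t1)))) s1 s2 t1 t2 Hs Ht).
    - intros p1 p2 q1 q2 Hp Hq H1 H2 H3 H4.
      rewrite (loop_split f a u k p1 ((p1 + p2) / 2) p2 q1 ((q1 + q2) / 2) q2)
        by assumption.
      eapply Rle_trans; [apply Cmod_triangle|].
      eapply Rle_trans; [apply Rplus_le_compat_r, Cmod_triangle|].
      eapply Rle_trans; [apply Rplus_le_compat_r, Rplus_le_compat_r, Cmod_triangle|].
      lra.
    - intros s t Hs' Ht'.
      set (z := zoom a u s t). destruct (Hf z) as [l Hl].
      rewrite is_derive_C_eps in Hl.
      set (e := eps / (2 * (1 + kap) * Lam)).
      assert (He' : 0 < e) by (apply Rdiv_lt_0_compat; [lra|]; repeat apply Rmult_lt_0_compat;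
          lra).
      destruct (Hl e He') as [d [Hd Hz]].
      assert (Hd' : 0 < d / (2 * Lam)) by (apply Rdiv_lt_0_compat; lra).
      exists (Rmin 1 (d / (2 * Lam))). split; [apply Rmin_pos; lra|].
      intros p1 p2 q1 q2 Hp Hq Hpd Hqd.
      assert (Hp1 := Rlt_le_trans _ _ _ Hpd (Rmin_l _ _)).
      assert (Hp2 := Rlt_le_trans _ _ _ Hpd (Rmin_r _ _)).
      assert (Hq2 := Rlt_le_trans _ _ _ Hqd (Rmin_r _ _)).
      set (sig := p2 - p1 + (q2 - q1)).
      assert (Hsig : 0 <= sig) by (unfold sig; lra).
      set (aff := fun w : C => (f z - l * (z - a) + l * (w - a))%C).
      set (rho := fun w : C => (f w + (- 1) * aff w)%C).
      assert (Haff : C_continuous aff) by apply C_continuous_affine.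
      assert (Hrho : C_continuous rho).
      { refine (C_continuous_ext _ _ _ (C_continuous_plus _ _ Hc
          (C_continuous_affine (l * (z - a) - f z)%C (- l)%C a))).
        intros w. unfold rho, aff. ring. }
      assert (Hsum : loop f a u k p1 p2 q1 q2 = loop rho a u k p1 p2 q1 q2).
      { pose proof (loop_plus aff rho a u k p1 p2 q1 q2 Haff Hrho Hu Hk) as HP.
        assert (HA0 : loop aff a u k p1 p2 q1 q2 = RtoC 0)
          by exact (loop_affine _ _ _ _ _ _ _ p1 p2 q1 q2 HL).
        rewrite HA0 in HP.
        replace (loop rho a u k p1 p2 q1 q2) with (0 + loop rho a u k p1 p2 q1 q2)%C by ring.
        rewrite <- HP. apply loop_ext. intros w. unfold rho. ring. }
      rewrite Hsum.
      assert (Hb : forall s' t', p1 <= s' <= p2 -> q1 <= t' <= q2 ->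
                 Cmod (rho (zoom a u s' t')) <= e * (Lam * sig)).
      { intros s' t' Hs2 Ht2.
        pose proof (zoom_Lipschitz a u k U kap (s2 + 1) s' s t' t HL ltac:(lra) ltac:(lra)) as HZ.
        fold z in HZ.
        assert (Habs : Rabs (s' - s) + Rabs (t' - t) <= sig).
        { unfold sig. apply Rplus_le_compat; apply Rabs_le; lra. }
        assert (HZ2 : Cmod (zoom a u s' t' - z) <= Lam * sig).
        { eapply Rle_trans; [exact HZ|].
          pose proof (Rabs_pos (s' - s)). pose proof (Rabs_pos (t' - t)).
          apply Rmult_le_compat; try lra.
          - unfold Lam in HLam. lra.
          - unfold Lam. lra. }
        assert (HZ3 : Lam * sig < d).
        { apply Rlt_le_trans with (Lam * (d / (2 * Lam) + d / (2 * Lam))).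
          - apply Rmult_lt_compat_l; unfold sig; lra.
          - right. field. lra. }
        specialize (Hz (zoom a u s' t') ltac:(lra)).
        unfold rho, aff.
        replace (f (zoom a u s' t') + (-1) * (f z - l * (z - a) + l * (zoom a u s' t' - a)))%C
          with (f (zoom a u s' t') - f z - (zoom a u s' t' - z) * l)%C by ring.
        eapply Rle_trans; [exact Hz|]. apply Rmult_le_compat_l; lra. }
      eapply Rle_trans; [apply (loop_le rho a u k U kap (e * (Lam * sig)) p1 p2 q1 q2 HL Hrho);
        [lra|lra|exact Hb]|].
      fold sig. right. unfold e. field. lra. }
  apply Cmod_eq_0. apply Rle_antisym; [|apply Cmod_ge_0].
  apply le_epsilon. intros eps He. rewrite Rplus_0_l.
  assert (HD : 0 <= D * D) by apply Rle_0_sqr.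
  eapply Rle_trans; [apply (Heps (eps / (1 + D * D)))|].
  - apply Rdiv_lt_0_compat; lra.
  - apply Rle_trans with (eps / (1 + D * D) * (1 + D * D)).
    + apply Rmult_le_compat_l; [left; apply Rdiv_lt_0_compat|]; lra.
    + right. field. lra.
Qed.

(** Cauchy's formula for a closed path that is star-shaped around [a].  By
    Goursat's lemma, and since the two rays at the ends of the period cancel, shrinking
    the path homothetically towards [a] leaves the integral unchanged; in the limit
    the factor [f] becomes the constant [f a]. *)
Lemma cauchy_star (f : C -> C) (a : C) (u k : R -> C) (U kap t1 t2 : R) :
  log_derivative u k U kap -> entire f -> t1 <= t2 -> u t1 = u t2 ->
  CInt (fun t => f (a + u t) * k t)%C t1 t2 = (f a * CInt k t1 t2)%C.
Proof.
  intros HL Hf Ht Hper.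
  pose proof (entire_continuous f Hf) as Hc.
  assert (Hu := ld_cont_u _ _ _ _ HL). assert (Hk := ld_cont_k _ _ _ _ HL).
  assert (U0 : 0 <= U) by (eapply Rle_trans; [apply Cmod_ge_0|apply (ld_bound_u _ _ _ _ HL 0)]).
  assert (K0 : 0 <= kap) by (eapply Rle_trans; [apply Cmod_ge_0|apply (ld_bound_k _ _ _ _ HL 0)]).
  assert (Hconst : forall s, s <= 0 -> arc f a u k 0 t1 t2 = arc f a u k s t1 t2).
  { intros s Hs. pose proof (loop_zero f a u k U kap s 0 t1 t2 HL Hf Hs Ht) as HZ.
    unfold loop in HZ.
    assert (HR : ray f a u t1 s 0 = ray f a u t2 s 0).
    { unfold ray, zoom. rewrite Hper. reflexivity. }
    rewrite HR in HZ. apply Ceq_minus. rewrite <- HZ. ring. }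
  assert (H0 : arc f a u k 0 t1 t2 = CInt (fun t => f (a + u t) * k t)%C t1 t2).
  { apply CInt_ext. intros t. unfold zoom. rewrite exp_0.
    replace (RtoC 1 * u t)%C with (u t) by ring. reflexivity. }
  rewrite <- H0. apply Ceq_minus, Cmod_eq_0. apply Rle_antisym; [|apply Cmod_ge_0].
  apply le_epsilon. intros eps He. rewrite Rplus_0_l.
  set (W := (t2 - t1) * kap).
  assert (HW : 0 <= W) by (apply Rmult_le_pos; lra).
  assert (He' : 0 < eps / (1 + W)) by (apply Rdiv_lt_0_compat; lra).
  destruct (Hc a _ He') as [d [Hd Hclose]].
  assert (Hd' : 0 < d / (1 + U)) by (apply Rdiv_lt_0_compat; lra).
  (* Shrink the path until it lies in the [d]-neighbourhood of [a]. *)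
  set (s := Rmin 0 (ln (d / (1 + U)))).
  rewrite (Hconst s (Rmin_l _ _)).
  assert (Hs : exp s <= d / (1 + U)).
  { rewrite <- (exp_ln _ Hd'). apply exp_monotone, Rmin_r. }
  unfold arc.
  rewrite <- CInt_scal by exact Hk.
  replace (CInt (fun t => f (zoom a u s t) * k t)%C t1 t2 - CInt (fun t => f a * k t)%C t1 t2)%C
    with (CInt (fun t => f (zoom a u s t) * k t + (-1) * (f a * k t))%C t1 t2).
  2:{ rewrite CInt_plus, CInt_scal.
      - ring.
      - apply path_cont_mult; [apply path_cont_const|exact Hk].
      - apply path_cont_zoom_t; assumption.
      - apply path_cont_mult; [apply path_cont_const|]. apply path_cont_mult;
          [apply path_cont_const|exact Hk]. }
  eapply Rle_trans; [apply (CInt_le _ t1 t2 (eps / (1 + W) * kap))|].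
  - apply path_cont_plus; [apply path_cont_zoom_t; assumption|].
    apply path_cont_mult; [apply path_cont_const|]. apply path_cont_mult;
        [apply path_cont_const|exact Hk].
  - exact Ht.
  - intros t _.
    replace (f (zoom a u s t) * k t + (-1) * (f a * k t))%C
      with ((f (zoom a u s t) - f a) * k t)%C by ring.
    rewrite Cmod_mult. apply Rmult_le_compat; try apply Cmod_ge_0.
    + left. apply Hclose. unfold zoom.
      replace (a + RtoC (exp s) * u t - a)%C with (RtoC (exp s) * u t)%C by ring.
      rewrite Cmod_mult, Cmod_R, Rabs_right by (left; apply exp_pos).
      pose proof (ld_bound_u _ _ _ _ HL t) as HUt.
      apply Rle_lt_trans with (d / (1 + U) * U).
      * apply Rmult_le_compat; try lra; [left; apply exp_pos|apply Cmod_ge_0].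
      * apply Rlt_le_trans with (d / (1 + U) * (1 + U)); [apply Rmult_lt_compat_l; lra|].
        right. field. lra.
    + apply (ld_bound_k _ _ _ _ HL).
  - apply Rle_trans with (eps / (1 + W) * (1 + W)).
    + unfold W in *.
      replace ((t2 - t1) * (eps / (1 + (t2 - t1) * kap) * kap))
        with (eps / (1 + (t2 - t1) * kap) * ((t2 - t1) * kap)) by ring.
      apply Rmult_le_compat_l; lra.
    + right. field. lra.
Qed.

(** * Power series expansion on a disc *)

Lemma CInt_pair (x y dx dy : R -> R) (a b : R) :
  (forall t, is_derive x t (dx t)) -> (forall t, is_derive y t (dy t)) ->
  (forall t, continuous dx t) -> (forall t, continuous dy t) ->
  CInt (fun t => (dx t, dy t)) a b = ((x b, y b) - (x a, y a))%C.
Proof.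
  intros Hx Hy Cx Cy. apply CInt_unique.
  apply (is_RInt_fct_extend_pair (U := R_NormedModule) (V := R_NormedModule)); simpl.
  - apply (is_RInt_derive (V := R_CompleteNormedModule) x dx); intros; auto.
  - apply (is_RInt_derive (V := R_CompleteNormedModule) y dy); intros; auto.
Qed.

Lemma path_cont_pair (x y : R -> R) :
  (forall t, continuous x t) -> (forall t, continuous y t) -> path_cont (fun t => (x t, y t)).
Proof.
  intros Hx Hy.
  pose proof (path_cont_plus _ _ (path_cont_RtoC x Hx)
    (path_cont_mult _ _ (path_cont_const Ci) (path_cont_RtoC y Hy))) as H.
  intros t. refine (continuous_ext (T := R_UniformSpace) (U := C_R_NormedModule) _ _ t _ (H t)).
  intros s. unfold Cplus, Cmult, Ci, RtoC. simpl. f_equal; ring.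
Qed.

Lemma path_cont_inv (h : R -> C) (m : R) :
  0 < m -> (forall t, m <= Cmod (h t)) -> path_cont h -> path_cont (fun t => / h t)%C.
Proof.
  intros Hm Hb Hh. apply path_cont_eps. intros t eps He.
  assert (He' : 0 < eps * (m * m)) by (repeat apply Rmult_lt_0_compat; lra).
  destruct (path_cont_elim h t _ Hh He') as [d [Hd H]].
  exists d. split; [exact Hd|]. intros x Hx. specialize (H x Hx).
  assert (N : forall s, h s <> 0).
  { intros s E. specialize (Hb s). rewrite E, Cmod_0 in Hb. lra. }
  replace (/ h x - / h t)%C with ((h t - h x) * (/ h x * / h t))%C
    by (field; split; apply N).
  rewrite !Cmod_mult, !Cmod_inv by apply N. rewrite Cmod_minus_sym in H.
  pose proof (Hb x). pose proof (Hb t).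
  rewrite <- Rinv_mult.
  apply Rmult_lt_reg_r with (Cmod (h x) * Cmod (h t)); [apply Rmult_lt_0_compat; lra|].
  rewrite Rmult_assoc, Rinv_l, Rmult_1_r by nra.
  eapply Rlt_le_trans; [exact H|]. apply Rmult_le_compat_l; [lra|].
  apply Rmult_le_compat; lra.
Qed.

Lemma path_cont_pow (h : R -> C) (n : nat) : path_cont h -> path_cont (fun t => h t ^ n)%C.
Proof.
  intros H. induction n as [|n IH]; [exact (path_cont_const 1)|].
  exact (path_cont_mult _ _ H IH).
Qed.

Lemma path_cont_csum (h : nat -> R -> C) (n : nat) :
  (forall j, path_cont (h j)) -> path_cont (fun t => csum (fun j => h j t) n).
Proof.
  intros H. induction n as [|n IH]; [exact (path_cont_const 0)|].
  exact (path_cont_plus _ _ IH (H n)).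
Qed.

Lemma CInt_csum (c : nat -> C) (h : nat -> R -> C) (a b : R) (n : nat) :
  (forall j, path_cont (h j)) ->
  CInt (fun t => csum (fun j => c j * h j t)%C n) a b
  = csum (fun j => c j * CInt (h j) a b)%C n.
Proof.
  intros H. induction n as [|n IH]; simpl.
  - rewrite CInt_const. ring.
  - rewrite CInt_plus, IH, CInt_scal; auto.
    + apply (path_cont_csum (fun j t => c j * h j t)%C).
      intros j. apply path_cont_mult; [apply path_cont_const|apply H].
    + apply path_cont_mult; [apply path_cont_const|apply H].
Qed.

Definition circle (r t : R) : C := (r * cos t, r * sin t).

Lemma Cmod_circle (r t : R) : 0 < r -> Cmod (circle r t) = r.
Proof.
  intros Hr. unfold Cmod, circle. simpl fst. simpl snd.
  replace ((r * cos t) ^ 2 + (r * sin t) ^ 2) with (r * r).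
  - apply sqrt_square. lra.
  - pose proof (sin2_cos2 t) as H. unfold Rsqr in H.
    replace ((r * cos t) ^ 2 + (r * sin t) ^ 2)
      with (r * r * (sin t * sin t + cos t * cos t)) by ring.
    rewrite H. ring.
Qed.

Lemma circle_neq_0 (r t : R) : 0 < r -> circle r t <> 0.
Proof. intros Hr E. pose proof (Cmod_circle r t Hr) as H. rewrite E, Cmod_0 in H. lra. Qed.

Lemma continuous_of_derive (g : R -> R) (t l : R) : is_derive g t l -> continuous g t.
Proof.
  intros H. apply (ex_derive_continuous (K := R_AbsRing) (V := R_NormedModule) g t).
  exists l. exact H.
Qed.

Lemma path_cont_circle (r : R) : path_cont (circle r).
Proof.
  apply path_cont_pair; intros t.
  - apply (continuous_of_derive _ t (r * - sin t)). auto_derive; [exact I|ring].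
  - apply (continuous_of_derive _ t (r * cos t)). auto_derive; [exact I|ring].
Qed.

Lemma CInt_circle (r a b : R) :
  CInt (fun t => Ci * circle r t)%C a b = (circle r b - circle r a)%C.
Proof.
  rewrite (CInt_ext _ (fun t => (- (r * sin t), r * cos t))).
  2: intros t; unfold Cmult, Ci, circle; simpl; f_equal; ring.
  apply (CInt_pair (fun t => r * cos t) (fun t => r * sin t)).
  - intros t. auto_derive; [exact I|ring].
  - intros t. auto_derive; [exact I|ring].
  - intros t. apply (continuous_of_derive _ t (- (r * cos t))). auto_derive; [exact I|ring].
  - intros t. apply (continuous_of_derive _ t (r * - sin t)). auto_derive; [exact I|ring].
Qed.

(** De Moivre's formula, by which the integrals of the negative powers over the
    circle are computed. *)
Lemma circle_inv_pow (r t : R) (n : nat) : 0 < r ->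
  ((/ circle r t) ^ n)%C = (RtoC (/ r ^ n) * (cos (INR n * t), (- sin (INR n * t))%R))%C.
Proof.
  intros Hr. induction n as [|n IH].
  - simpl. rewrite Rmult_0_l, cos_0, sin_0, Rinv_1.
    unfold Cmult, RtoC. simpl. f_equal; ring.
  - rewrite Cpow_S, IH.
    assert (E : (/ circle r t)%C = (RtoC (/ r) * (cos t, (- sin t)%R))%C).
    { assert (H1 : (circle r t * (RtoC (/ r) * (cos t, (- sin t)%R)))%C = RtoC 1).
      { pose proof (sin2_cos2 t) as H. unfold Rsqr in H.
        unfold circle, Cmult, RtoC. simpl. f_equal.
        - rewrite <- H. field. lra.
        - field. lra. }
      rewrite <- (Cmult_1_r (/ circle r t)%C), <- H1.
      rewrite Cmult_assoc, Cinv_l by (apply circle_neq_0, Hr). ring. }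
    rewrite E, S_INR.
    replace ((INR n + 1) * t) with (t + INR n * t) by ring.
    rewrite cos_plus, sin_plus.
    pose proof (pow_lt r n Hr).
    unfold Cmult, RtoC. simpl. f_equal; field; split; lra.
Qed.

Lemma CInt_circle_inv_pow (r : R) (n : nat) : 0 < r ->
  CInt (fun t => (/ circle r t) ^ n)%C 0 (2 * PI)
  = match n with O => RtoC (2 * PI) | S _ => RtoC 0 end.
Proof.
  intros Hr. destruct n as [|n].
  - rewrite (CInt_ext _ (fun _ => RtoC 1)) by reflexivity.
    rewrite CInt_const, Rminus_0_r. ring.
  - assert (Hm : INR (S n) <> 0) by (apply not_0_INR; discriminate).
    set (m := S n) in *. clearbody m.
    rewrite (CInt_ext _ (fun t => RtoC (/ r ^ m) * (cos (INR m * t), (- sin (INR m * t))%R))%C)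
      by (intros t; apply circle_inv_pow, Hr).
    assert (Hc : forall t, continuous (fun t => cos (INR m * t)) t).
    { intros t. apply (continuous_of_derive _ t (INR m * - sin (INR m * t))).
      auto_derive; [exact I|ring]. }
    assert (Hs : forall t, continuous (fun t => - sin (INR m * t)) t).
    { intros t. apply (continuous_of_derive _ t (- (INR m * cos (INR m * t)))).
      auto_derive; [exact I|ring]. }
    rewrite CInt_scal by (apply path_cont_pair; assumption).
    rewrite (CInt_pair (fun t => sin (INR m * t) / INR m) (fun t => cos (INR m * t) / INR m));
      [| | |assumption|assumption].
    + replace (INR m * (2 * PI)) with (0 + 2 * INR m * PI) by ring.
      rewrite sin_period, cos_period, Rmult_0_r.
      ring.
    + intros t. auto_derive; [exact I|]. field. exact Hm.
    + intros t. auto_derive; [exact I|]. field. exact Hm.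
Qed.

(** The logarithmic derivative of [circle r - a]. *)
Definition cauchy_kernel (r : R) (a : C) (t : R) : C :=
  (Ci * circle r t * / (circle r t - a))%C.

Lemma circle_minus_lower (r t : R) (a : C) : 0 < r -> Cmod a <= r / 2 ->
  r / 2 <= Cmod (circle r t - a).
Proof.
  intros Hr Ha. pose proof (Cmod_circle r t Hr).
  pose proof (Cmod_triangle (circle r t - a) a) as H1.
  replace (circle r t - a + a)%C with (circle r t) in H1 by ring. lra.
Qed.

Lemma circle_minus_neq_0 (r t : R) (a : C) : 0 < r -> Cmod a <= r / 2 ->
  (circle r t - a)%C <> 0.
Proof.
  intros Hr Ha E. pose proof (circle_minus_lower r t a Hr Ha) as H.
  rewrite E, Cmod_0 in H. lra.
Qed.

Lemma path_cont_circle_minus (r : R) (a : C) : path_cont (fun t => circle r t - a)%C.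
Proof. apply path_cont_plus; [apply path_cont_circle|apply path_cont_const]. Qed.

Lemma circle_log_derivative (r : R) (a : C) : 0 < r -> Cmod a <= r / 2 ->
  log_derivative (fun t => circle r t - a)%C (cauchy_kernel r a) (2 * r) 2.
Proof.
  intros Hr Ha. split.
  - apply path_cont_circle_minus.
  - apply path_cont_mult; [apply path_cont_mult; [apply path_cont_const|apply path_cont_circle]|].
    apply (path_cont_inv _ (r / 2)); [lra| |apply path_cont_circle_minus].
    intros t. apply circle_minus_lower; assumption.
  - intros t1 t2.
    rewrite (CInt_ext _ (fun t => Ci * circle r t)%C).
    + rewrite CInt_circle. ring.
    + intros t. unfold cauchy_kernel. field. apply circle_minus_neq_0; assumption.
  - intros t. unfold Cminus. eapply Rle_trans; [apply Cmod_triangle|].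
    rewrite Cmod_opp, Cmod_circle by assumption. lra.
  - intros t. unfold cauchy_kernel.
    rewrite !Cmod_mult, Cmod_Ci, Cmod_circle, Cmod_inv by
      (auto; apply circle_minus_neq_0; assumption).
    pose proof (circle_minus_lower r t a Hr Ha) as H.
    apply Rmult_le_reg_r with (Cmod (circle r t - a)); [lra|].
    rewrite Rmult_assoc, Rinv_l by lra. lra.
Qed.

Lemma geometric_kernel (q : C) (n : nat) : (1 - q)%C <> 0 ->
  (/ (1 - q))%C = (csum (fun j => q ^ j)%C n + q ^ n * / (1 - q))%C.
Proof.
  intros Hq. induction n as [|n IH]; simpl.
  - ring.
  - rewrite IH at 1. field. exact Hq.
Qed.

(** Up to the factor [2 * PI * Ci], the coefficient of index [n] of the power
    series of [f], as an integral over the circle of radius [r]. *)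
Definition moment (f : C -> C) (r : R) (n : nat) : C :=
  CInt (fun t => f (circle r t) * (Ci * (/ circle r t) ^ n))%C 0 (2 * PI).

Lemma path_cont_moment (f : C -> C) (r : R) (n : nat) : 0 < r -> C_continuous f ->
  path_cont (fun t => f (circle r t) * (Ci * (/ circle r t) ^ n))%C.
Proof.
  intros Hr Hf. apply path_cont_mult; [apply path_cont_comp; [exact Hf|apply path_cont_circle]|].
  apply path_cont_mult; [apply path_cont_const|]. apply path_cont_pow.
  apply (path_cont_inv _ r Hr); [|apply path_cont_circle].
  intros t. rewrite Cmod_circle by exact Hr. lra.
Qed.

Lemma moment_le (f : C -> C) (r M : R) (n : nat) : 0 < r -> C_continuous f ->
  (forall t, Cmod (f (circle r t)) <= M) ->
  Cmod (moment f r n) <= 2 * PI * (M / r ^ n).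
Proof.
  intros Hr Hf HM. pose proof PI_RGT_0. pose proof (pow_lt r n Hr).
  eapply Rle_trans; [apply (CInt_le _ 0 (2 * PI) (M / r ^ n))|lra].
  - apply path_cont_moment; assumption.
  - lra.
  - intros t _.
    rewrite !Cmod_mult, Cmod_Ci, Cmod_pow, Cmod_inv, Cmod_circle by
      (auto; apply circle_neq_0; assumption).
    rewrite pow_inv, Rmult_1_l. apply Rmult_le_compat_r; [|apply HM].
    left. apply Rinv_0_lt_compat. assumption.
Qed.

(** On the circle [1 / (z - a)] is a geometric series in [a / z] of ratio at most
    [1/2]; the remainder after [n] terms is integrated and bounded directly, which
    spares a theorem on termwise integration. *)
Lemma cauchy_kernel_series (f : C -> C) (r M : R) (a : C) :
  0 < r -> Cmod a <= r / 2 -> C_continuous f -> (forall t, Cmod (f (circle r t)) <= M) ->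
  is_Cseries
    (fun n => a ^ n * moment f r n)%C
    (CInt (fun t => f (circle r t) * cauchy_kernel r a t)%C 0 (2 * PI)).
Proof.
  intros Hr Ha Hf HM.
  pose proof PI_RGT_0.
  assert (M0 : 0 <= M) by (eapply Rle_trans; [apply Cmod_ge_0|apply (HM 0)]).
  assert (HL := circle_log_derivative r a Hr Ha).
  assert (Hk := ld_cont_k _ _ _ _ HL).
  assert (Hfc : path_cont (fun t => f (circle r t))) by (apply path_cont_comp; [exact Hf|
      apply path_cont_circle]).
  assert (Hinv : path_cont (fun t => / circle r t)%C).
  { apply (path_cont_inv _ r Hr); [|apply path_cont_circle].
    intros t. rewrite Cmod_circle by exact Hr. lra. }
  apply (is_series_squeeze _ _ (fun n => (2 * PI * (M * 2)) * (INR n + 1) * (1/2)^n));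
    [|apply linear_geometric_lim].
  intros n.
  set (rem := fun t => (f (circle r t) * ((a * / circle r t) ^ n * cauchy_kernel r a t))%C).
  assert (Hrem : path_cont rem).
  { apply path_cont_mult; [exact Hfc|]. apply path_cont_mult; [|exact Hk].
    apply path_cont_pow. apply path_cont_mult; [apply path_cont_const|exact Hinv]. }
  assert (E : CInt (fun t => f (circle r t) * cauchy_kernel r a t)%C 0 (2 * PI)
    = (csum (fun j => a ^ j * moment f r j)%C n + CInt rem 0 (2 * PI))%C).
  { unfold moment.
    rewrite <- (CInt_csum (fun j => a ^ j)%C
      (fun j t => f (circle r t) * (Ci * (/ circle r t) ^ j))%C)
      by (intros j; apply path_cont_moment; assumption).
    rewrite <- CInt_plus; [|apply (path_cont_csum
      (fun j t => a ^ j * (f (circle r t) * (Ci * (/ circle r t) ^ j)))%C)|exact Hrem].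
    - apply CInt_ext. intros t. unfold rem.
      assert (N1 := circle_neq_0 r t Hr). assert (N2 := circle_minus_neq_0 r t a Hr Ha).
      assert (Hq : (1 - a * / circle r t)%C <> 0).
      { intros E. apply N2.
        replace (circle r t - a)%C with (circle r t * (1 - a * / circle r t))%C
          by (field; exact N1).
        rewrite E. ring. }
      assert (Ek : cauchy_kernel r a t = (Ci * / (1 - a * / circle r t))%C).
      { unfold cauchy_kernel. field. split; [exact N1|].
        intros E; apply N2. rewrite <- E. ring. }
      rewrite (csum_ext _ (fun j => (f (circle r t) * Ci) * (a * / circle r t) ^ j)%C).
      + rewrite (csum_scal _ (fun j => (a * / circle r t) ^ j)%C), Ek.
        rewrite (geometric_kernel _ n Hq) at 1. ring.
      + intros j _. rewrite Cpow_mult_l. ring.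
    - intros j. apply path_cont_mult; [apply path_cont_const|]. apply path_cont_moment;
        assumption. }
  rewrite E.
  replace (csum (fun j => a ^ j * moment f r j)%C n
    - (csum (fun j => a ^ j * moment f r j)%C n + CInt rem 0 (2 * PI)))%C
    with (- CInt rem 0 (2 * PI))%C by ring.
  rewrite Cmod_opp.
  eapply Rle_trans; [apply (CInt_le _ 0 (2 * PI) (M * ((1/2)^n * 2)) Hrem)|].
  - lra.
  - intros t _. unfold rem. rewrite !Cmod_mult.
    apply Rmult_le_compat; [apply Cmod_ge_0| |apply HM|].
    { apply Rmult_le_pos; apply Cmod_ge_0. }
    apply Rmult_le_compat; try apply Cmod_ge_0; [|apply (ld_bound_k _ _ _ _ HL)].
    rewrite Cmod_pow. apply pow_incr. split; [apply Cmod_ge_0|].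
    rewrite Cmod_mult, Cmod_inv, Cmod_circle by (auto; apply circle_neq_0; assumption).
    apply Rmult_le_reg_r with r; [exact Hr|]. rewrite Rmult_assoc, Rinv_l by lra. lra.
  - pose proof (half_pow_pos n). pose proof (pos_INR n).
    assert (0 <= 2 * PI * M * (1/2)^n * INR n) by (repeat (apply Rmult_le_pos; try lra)).
    lra.
Qed.

(** The expansion of the kernel for [f = 1]: all moments but the first vanish, so
    the winding integral does not depend on [a]. *)
Lemma CInt_cauchy_kernel (r : R) (a : C) : 0 < r -> Cmod a <= r / 2 ->
  CInt (cauchy_kernel r a) 0 (2 * PI) = (RtoC (2 * PI) * Ci)%C.
Proof.
  intros Hr Ha.
  assert (H1 : C_continuous (fun _ => RtoC 1)).
  { intros z eps He. exists 1. split; [lra|]. intros w _.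
    replace (1 - 1)%C with (RtoC 0) by ring. rewrite Cmod_0. exact He. }
  pose proof (cauchy_kernel_series (fun _ => RtoC 1) r 1 a Hr Ha H1) as H.
  assert (Hm : forall n, moment (fun _ => RtoC 1) r n
     = match n with O => (RtoC (2 * PI) * Ci)%C | S _ => RtoC 0 end).
  { intros n. unfold moment.
    rewrite (CInt_ext _ (fun t => Ci * (/ circle r t) ^ n)%C) by (intros t; ring).
    rewrite CInt_scal, CInt_circle_inv_pow; [destruct n; ring|exact Hr|].
    apply path_cont_pow, (path_cont_inv _ r Hr); [|apply path_cont_circle].
    intros t. rewrite Cmod_circle by exact Hr. lra. }
  rewrite <- (CInt_ext (fun t => 1 * cauchy_kernel r a t)%C) by (intros t; ring).
  apply (is_series_C_unique _ _ _ (H ltac:(intros t; right; exact Cmod_1))).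
  refine (is_Cseries_ext _ _ _ _ (is_Cseries_single _)).
  intros [|n]; rewrite Hm; simpl; ring.
Qed.

Lemma cauchy_power_series (f : C -> C) (r M : R) :
  entire f -> 0 < r -> (forall t, Cmod (f (circle r t)) <= M) ->
  exists c : nat -> C,
    (forall n, Cmod (c n) <= M / r ^ n) /\
    forall a, Cmod a <= r / 2 ->
      is_Cseries (fun n => c n * a ^ n)%C (f a).
Proof.
  intros Hf Hr HM. pose proof (entire_continuous f Hf) as Hc. pose proof PI_RGT_0 as HPI.
  set (w := (RtoC (2 * PI) * Ci)%C).
  assert (Hw : Cmod w = 2 * PI).
  { unfold w. rewrite Cmod_mult, Cmod_Ci, Cmod_R, Rabs_right; lra. }
  assert (Nw : w <> 0). { intros E. rewrite E, Cmod_0 in Hw. lra. }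
  exists (fun n => / w * moment f r n)%C. split.
  - intros n. rewrite Cmod_mult, Cmod_inv, Hw by exact Nw.
    pose proof (moment_le f r M n Hr Hc HM).
    apply Rmult_le_reg_l with (2 * PI); [lra|].
    rewrite <- Rmult_assoc, Rinv_r, Rmult_1_l by lra. assumption.
  - intros a Ha.
    pose proof (cauchy_kernel_series f r M a Hr Ha Hc HM) as HS.
    pose proof (cauchy_star f a _ _ _ _ 0 (2 * PI) (circle_log_derivative r a Hr Ha) Hf
      ltac:(lra)) as HC.
    cbv beta in HC.
    rewrite (CInt_ext _ (fun t => f (circle r t) * cauchy_kernel r a t)%C) in HC by
      (intros t; do 2 f_equal; ring).
    rewrite HC, CInt_cauchy_kernel in HS by
      (auto; unfold circle; rewrite cos_2PI, sin_2PI, cos_0, sin_0; reflexivity).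
    fold w in HS.
    apply (is_series_scal_l (K := C_AbsRing) (V := C_NormedModule) (/ w)%C) in HS.
    change (scal (/ w)%C (f a * w)%C) with (/ w * (f a * w))%C in HS.
    replace (/ w * (f a * w))%C with (f a) in HS by (field; exact Nw).
    refine (is_series_ext _ _ _ _ HS). intros n.
    change ((/ w * (a ^ n * moment f r n))%C = (/ w * moment f r n * a ^ n)%C). ring.
Qed.

(** * Taylor expansion of functions of exponential type *)

(** Divided powers: with them the binomial formula is a convolution without
    binomial coefficients. *)
Definition dpow (n : nat) (a : C) : C := (a ^ n / RtoC (INR (fact n)))%C.

Lemma INR_C_neq_0 (n : nat) : n <> O -> RtoC (INR n) <> 0.
Proof. intros H E. apply RtoC_inj in E. exact (not_0_INR n H E). Qed.

Lemma fact_C_neq_0 (n : nat) : RtoC (INR (fact n)) <> 0.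
Proof. apply INR_C_neq_0, fact_neq_0. Qed.

Ltac nonzero := repeat split;
  first [apply fact_C_neq_0 | apply INR_C_neq_0; discriminate | assumption].

Lemma fact_C_S (n : nat) :
  RtoC (INR (fact (S n))) = (RtoC (INR (S n)) * RtoC (INR (fact n)))%C.
Proof. rewrite fact_simpl, mult_INR, RtoC_mult. reflexivity. Qed.

Lemma INR_C_S (n : nat) : RtoC (INR (S n)) = (RtoC (INR n) + 1)%C.
Proof. rewrite S_INR, RtoC_plus. reflexivity. Qed.

Lemma INR_C_add (m n : nat) : RtoC (INR (m + n)) = (RtoC (INR m) + RtoC (INR n))%C.
Proof. rewrite plus_INR, RtoC_plus. reflexivity. Qed.

Lemma dpow_0 (a : C) : dpow 0 a = RtoC 1.
Proof. unfold dpow. simpl. field. Qed.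

Lemma dpow_S (n : nat) (a : C) : (RtoC (INR (S n)) * dpow (S n) a)%C = (a * dpow n a)%C.
Proof.
  unfold dpow. rewrite fact_C_S, Cpow_S. field.
  nonzero.
Qed.

(** If the coefficients of smaller index vanish, dividing the series at a small
    real [h] by [h ^ n] shows that the next coefficient is [O(h)].  This makes the
    coefficients obtained from circles of different radii coincide. *)
Lemma power_series_unique (d : nat -> C) (B r : R) :
  0 < r -> (forall n, Cmod (d n) <= B / r ^ n) ->
  (forall a, Cmod a <= r / 2 -> is_Cseries (fun n => d n * a ^ n)%C (RtoC 0)) ->
  forall n, d n = RtoC 0.
Proof.
  intros Hr HB Hs n.
  assert (B0 : 0 <= B).
  { specialize (HB O). pose proof (Cmod_ge_0 (d O)). simpl in HB. lra. }
  induction n as [n IH] using (well_founded_induction Wf_nat.lt_wf).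
  assert (Hh : forall h, 0 < h <= r / 2 -> Cmod (d n) <= h * (2 * B / r ^ S n)).
  { intros h Hh.
    assert (Ch : Cmod (RtoC h) = h) by (rewrite Cmod_R, Rabs_right; lra).
    assert (Hs' := Hs (RtoC h) ltac:(lra)).
    apply (is_Cseries_shift _ _ (S n)) in Hs'.
    assert (E : csum (fun k => d k * RtoC h ^ k)%C (S n) = (d n * RtoC h ^ n)%C).
    { simpl. rewrite csum_zero; [ring|]. intros k Hk. rewrite IH by exact Hk. ring. }
    rewrite E in Hs'.
    pose proof (pow_lt r (S n) Hr) as Hrn. pose proof (pow_lt h n ltac:(lra)) as Hhn.
    assert (HT : forall k, Cmod (d (S n + k)%nat * RtoC h ^ (S n + k))
               <= (B * h ^ S n / r ^ S n) * (1/2) ^ k).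
    { intros k. rewrite Cmod_mult, Cmod_pow, Ch.
      pose proof (pow_lt r k Hr) as Hrk. pose proof (pow_lt h (S n) ltac:(lra)).
      apply Rle_trans with (B / r ^ (S n + k) * h ^ (S n + k)).
      - apply Rmult_le_compat_r; [apply pow_le; lra|apply HB].
      - rewrite !pow_add.
        replace (B / (r ^ S n * r ^ k) * (h ^ S n * h ^ k))
          with (B * h ^ S n / r ^ S n * ((h / r) ^ k))
          by (unfold Rdiv at 2; rewrite Rpow_mult_distr, pow_inv; field; lra).
        apply Rmult_le_compat_l.
        + apply Rmult_le_pos; [apply Rmult_le_pos; lra|left; apply Rinv_0_lt_compat, Hrn].
        + apply pow_incr. split; [apply Rdiv_le_0_compat; lra|].
          apply Rmult_le_reg_r with r; [exact Hr|]. unfold Rdiv at 1.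
          rewrite Rmult_assoc, Rinv_l by lra. lra. }
    pose proof (geometric_tail _ _ _ HT Hs' O) as HF. simpl csum in HF.
    replace (0 - d n * RtoC h ^ n - 0)%C with (- (d n * RtoC h ^ n))%C in HF by ring.
    rewrite Cmod_opp, Cmod_mult, Cmod_pow, Ch in HF. simpl pow in HF.
    apply Rmult_le_reg_r with (h ^ n); [exact Hhn|].
    eapply Rle_trans; [exact HF|]. right. simpl. field. split; [|lra].
    apply Rgt_not_eq, pow_lt, Hr. }
  apply Cmod_eq_0, Rle_antisym; [|apply Cmod_ge_0].
  apply le_epsilon. intros eps He. rewrite Rplus_0_l.
  set (Q := 2 * B / r ^ S n) in *.
  assert (HQ : 0 <= Q).
  { apply Rmult_le_pos; [lra|]. left. apply Rinv_0_lt_compat, pow_lt, Hr. }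
  assert (He' : 0 < eps / (1 + Q)) by (apply Rdiv_lt_0_compat; lra).
  eapply Rle_trans; [apply (Hh (Rmin (r / 2) (eps / (1 + Q))))|].
  - split; [apply Rmin_pos; lra|apply Rmin_l].
  - apply Rle_trans with (eps / (1 + Q) * (1 + Q)).
    + apply Rmult_le_compat; try lra.
      * left. apply Rmin_pos; lra.
      * apply Rmin_r.
    + right. field. lra.
Qed.

Lemma fact_le_pow (n : nat) : INR (fact n) <= INR n ^ n.
Proof.
  assert (H : (fact n <= n ^ n)%nat).
  { induction n as [|n IH]; [simpl; lia|].
    change (fact (S n)) with (S n * fact n)%nat. rewrite Nat.pow_succ_r'.
    apply Nat.mul_le_mono_l. eapply Nat.le_trans; [exact IH|].
    apply Nat.pow_le_mono_l. lia. }
  rewrite <- pow_INR. apply le_INR, H.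
Qed.

(** Because the coefficients do not depend on the radius, the Cauchy estimate for
    the coefficient of index [n] may be taken on the circle of radius [n], where [f] is
    at most [M * exp K ^ n]; since [n! <= n ^ n], this is geometric growth of the
    derivatives at [0]. *)
Lemma entire_power_series (f : C -> C) (M K : R) :
  entire f -> 0 <= M -> (forall z, Cmod (f z) <= M * exp (K * Cmod z)) ->
  exists A : nat -> C,
    (forall n, Cmod (A n) <= M * exp K ^ n) /\
    forall z, is_Cseries (fun n => A n * dpow n z)%C (f z).
Proof.
  intros Hf HM Hexp.
  assert (HP : forall r, 0 < r -> exists c : nat -> C,
    (forall n, Cmod (c n) <= M * exp (K * r) / r ^ n) /\
    forall a, Cmod a <= r / 2 -> is_Cseries (fun n => c n * a ^ n)%C (f a)).
  { intros r Hr. apply (cauchy_power_series f r); [exact Hf|exact Hr|].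
    intros t. eapply Rle_trans; [apply Hexp|]. rewrite Cmod_circle by exact Hr. lra. }
  destruct (HP 1 Rlt_0_1) as [c [Hc1 Hs1]].
  assert (HU : forall r, 1 <= r ->
    (forall n, Cmod (c n) <= M * exp (K * r) / r ^ n) /\
    forall a, Cmod a <= r / 2 -> is_Cseries (fun n => c n * a ^ n)%C (f a)).
  { intros r Hr. destruct (HP r ltac:(lra)) as [c' [Hc' Hs']].
    assert (E : forall n, c' n = c n).
    { intros n. apply Ceq_minus.
      apply (power_series_unique (fun n => c' n - c n)%C
        (M * exp (K * r) + M * exp (K * 1)) 1 Rlt_0_1).
      - intros j. unfold Cminus. eapply Rle_trans; [apply Cmod_triangle|].
        rewrite Cmod_opp. specialize (Hc1 j). specialize (Hc' j).
        rewrite pow1 in *.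
        pose proof (pow_R1_Rle r j Hr) as Hrj.
        assert (M * exp (K * r) / r ^ j <= M * exp (K * r) / 1).
        { apply Rmult_le_compat_l.
          - apply Rmult_le_pos; [exact HM|left; apply exp_pos].
          - apply Rinv_le_contravar; lra. }
        lra.
      - intros a Ha.
        pose proof (is_Cseries_plus _ _ _ _ (Hs' a ltac:(lra))
          (is_Cseries_scal (-1) _ _ (Hs1 a Ha))) as H.
        replace (f a + -1 * f a)%C with (RtoC 0) in H by ring.
        refine (is_Cseries_ext _ _ _ _ H). intros j. cbv beta. ring. }
    split.
    - intros n. rewrite <- E. apply Hc'.
    - intros a Ha. apply (is_Cseries_ext (fun n => c' n * a ^ n)%C).
      + intros n. rewrite E. reflexivity.
      + apply Hs', Ha. }
  exists (fun n => RtoC (INR (fact n)) * c n)%C. split.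
  - intros n. rewrite Cmod_mult, Cmod_R, Rabs_right by (apply Rle_ge, pos_INR).
    destruct n as [|n].
    + simpl. rewrite Rmult_1_l, Rmult_1_r.
      pose proof (proj2 (HU 1 (Rle_refl 1)) 0%C) as H0.
      rewrite Cmod_0 in H0. specialize (H0 ltac:(lra)).
      apply (is_Cseries_shift _ _ 1) in H0.
      assert (Ec : c O = f 0).
      { apply Ceq_minus.
        assert (Z : (f 0 - c O)%C = RtoC 0).
        { apply (is_series_C_unique (fun k => c (1 + k)%nat * 0 ^ (1 + k))%C).
          - replace (f 0 - c O)%C with (f 0 - csum (fun n => c n * 0 ^ n)%C 1)%C
              by (simpl; ring). exact H0.
          - refine (is_Cseries_ext _ _ _ _ (is_Cseries_single 0)).
            intros [|k]; simpl; ring. }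
        replace (c O - f 0)%C with (- (f 0 - c O))%C by ring. rewrite Z. ring. }
      rewrite Ec. eapply Rle_trans; [apply Hexp|]. rewrite Cmod_0, Rmult_0_r, exp_0. lra.
    + set (m := S n). assert (Hm : 1 <= INR m) by (apply (le_INR 1); unfold m; lia).
      pose proof (proj1 (HU (INR m) Hm) m) as H.
      pose proof (fact_le_pow m) as Hfact.
      assert (Hpm : 0 < INR m ^ m) by (apply pow_lt; lra).
      replace (exp K ^ m) with (exp (K * INR m)).
      2:{ rewrite Rmult_comm. symmetry.
          rewrite <- Rpower_pow by apply exp_pos. unfold Rpower. rewrite ln_exp. reflexivity. }
      apply Rle_trans with (INR m ^ m * (M * exp (K * INR m) / INR m ^ m)).
      * apply Rmult_le_compat; [apply pos_INR|apply Cmod_ge_0|exact Hfact|exact H].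
      * right. field. lra.
  - intros z.
    pose proof (proj2 (HU (1 + 2 * Cmod z) ltac:(pose proof (Cmod_ge_0 z);
        lra)) z ltac:(lra)) as H.
    refine (is_Cseries_ext _ _ _ _ H). intros n. unfold dpow. field. apply fact_C_neq_0.
Qed.

Lemma pow_fact_le_exp (t : R) (n : nat) : 0 <= t -> t ^ n / INR (fact n) <= exp t.
Proof.
  intros Ht. pose proof (exp_ge_taylor t n Ht) as H.
  eapply Rle_trans; [|exact H]. destruct n as [|n]; [right; reflexivity|].
  assert (0 <= sum_f_R0 (fun k => t ^ k / INR (fact k)) n).
  { apply cond_pos_sum. intros k. apply Rdiv_le_0_compat; [apply pow_le, Ht|
      apply INR_fact_lt_0]. }
  change (t ^ S n / INR (fact (S n)) <=
    sum_f_R0 (fun k => t ^ k / INR (fact k)) n + t ^ S n / INR (fact (S n))). lra.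
Qed.

Lemma pow_fact_le_half (t : R) (n : nat) : 0 <= t ->
  t ^ n / INR (fact n) <= exp (2 * t) * (1/2) ^ n.
Proof.
  intros Ht. pose proof (pow_fact_le_exp (2 * t) n ltac:(lra)) as H.
  pose proof (INR_fact_lt_0 n).
  replace (t ^ n) with ((2 * t) ^ n * (1/2) ^ n)
    by (rewrite <- Rpow_mult_distr; f_equal; lra).
  pose proof (half_pow_pos n).
  replace ((2 * t) ^ n * (1 / 2) ^ n / INR (fact n))
    with ((2 * t) ^ n / INR (fact n) * (1/2) ^ n) by (field; lra).
  apply Rmult_le_compat_r; lra.
Qed.

Lemma Cmod_taylor_term (A z : C) (n : nat) :
  Cmod (A * dpow n z) = Cmod A * (Cmod z ^ n / INR (fact n)).
Proof.
  unfold dpow. rewrite Cmod_mult, Cmod_div, Cmod_pow, Cmod_R, Rabs_right; auto.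
  - apply Rle_ge, pos_INR.
  - apply fact_C_neq_0.
Qed.

Lemma taylor_term_le (A : nat -> C) (M L : R) (z : C) (n : nat) : 0 <= M -> 0 <= L ->
  (forall n, Cmod (A n) <= M * L ^ n) ->
  Cmod (A n * dpow n z) <= M * exp (2 * (L * Cmod z)) * (1/2) ^ n.
Proof.
  intros HM HL HA. rewrite Cmod_taylor_term.
  pose proof (Cmod_ge_0 z) as Hz.
  assert (HLz : 0 <= L * Cmod z) by (apply Rmult_le_pos; assumption).
  pose proof (pow_fact_le_half (L * Cmod z) n HLz) as H.
  pose proof (INR_fact_lt_0 n).
  apply Rle_trans with (M * L ^ n * (Cmod z ^ n / INR (fact n))).
  - apply Rmult_le_compat_r; [|apply HA].
    apply Rdiv_le_0_compat; [apply pow_le, Hz|assumption].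
  - rewrite Rpow_mult_distr in H.
    replace (M * L ^ n * (Cmod z ^ n / INR (fact n)))
      with (M * (L ^ n * Cmod z ^ n / INR (fact n))) by (field; lra).
    rewrite Rmult_assoc. apply Rmult_le_compat_l; assumption.
Qed.

(** The second-order Taylor remainder of a power, with the recursion that expresses
    the remainder of one exponent through that of the previous one. *)
Lemma pow_remainder_le (w h : C) (rho : R) (n : nat) :
  Cmod w <= rho -> Cmod (w + h) <= rho ->
  Cmod ((w + h) ^ S (S n) - w ^ S (S n) - RtoC (INR (S (S n))) * h * w ^ S n)
    <= INR (S (S n)) * INR (S n) * (Cmod h * Cmod h) * rho ^ n.
Proof.
  intros Hw Hwh.
  assert (R0 : 0 <= rho) by (eapply Rle_trans; [apply Cmod_ge_0|exact Hw]).
  pose proof (Cmod_ge_0 h) as Hh0.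
  assert (Hhh : 0 <= Cmod h * Cmod h) by (apply Rmult_le_pos; lra).
  induction n as [|n IH].
  - replace ((w + h) ^ 2 - w ^ 2 - RtoC (INR 2) * h * w ^ 1)%C with (h * h)%C
      by (simpl; rewrite RtoC_plus; ring).
    rewrite Cmod_mult. simpl. lra.
  - rewrite (S_INR (S (S n))).
    replace ((w + h) ^ S (S (S n)) - w ^ S (S (S n))
         - RtoC (INR (S (S n)) + 1) * h * w ^ S (S n))%C
      with ((w + h) * ((w + h) ^ S (S n) - w ^ S (S n) - RtoC (INR (S (S n))) * h * w ^ S n)
            + RtoC (INR (S (S n))) * (h * h) * w ^ S n)%C
      by (rewrite RtoC_plus, !Cpow_S; ring).
    eapply Rle_trans; [apply Cmod_triangle|]. rewrite !Cmod_mult, Cmod_pow, Cmod_R.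
    rewrite (Rabs_right (INR (S (S n)))) by (apply Rle_ge, pos_INR).
    assert (H1 : Cmod w ^ S n <= rho ^ S n) by (apply pow_incr; split;
        [apply Cmod_ge_0|exact Hw]).
    pose proof (pow_le rho n R0). pose proof (pow_le rho (S n) R0).
    pose proof (pos_INR n) as Hn. rewrite !S_INR in *.
    eapply Rle_trans; [apply Rplus_le_compat|].
    + apply Rmult_le_compat; [apply Cmod_ge_0|apply Cmod_ge_0|exact Hwh|exact IH].
    + apply Rmult_le_compat_l; [|exact H1]. apply Rmult_le_pos; [lra|exact Hhh].
    + change (rho ^ S n) with (rho * rho ^ n).
      set (X := Cmod h * Cmod h) in *. set (Y := rho * rho ^ n) in *.
      assert (0 <= X * Y) by (apply Rmult_le_pos; assumption).
      replace (rho * ((INR n + 1 + 1) * (INR n + 1) * X * rho ^ n))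
        with ((INR n + 1 + 1) * (INR n + 1) * (X * Y)) by (unfold Y; ring).
      replace ((INR n + 1 + 1) * X * Y) with ((INR n + 1 + 1) * (X * Y)) by ring.
      replace ((INR n + 1 + 1 + 1) * (INR n + 1 + 1) * X * Y)
        with ((INR n + 1 + 1 + 1) * (INR n + 1 + 1) * (X * Y)) by ring.
      nra.
Qed.

(** By the bound on the second-order remainders of the powers, the difference
    between [f w - f z] and its candidate linear part is at most
    [B * Cmod (w - z) ^ 2] with [B] uniform for [w] within distance [1] of [z]. *)
Lemma power_series_derive (A : nat -> C) (M L : R) (f g : C -> C) :
  0 <= M -> 0 <= L -> (forall n, Cmod (A n) <= M * L ^ n) ->
  (forall z, is_Cseries (fun n => A n * dpow n z)%C (f z)) ->
  (forall z, is_Cseries (fun n => A (S n) * dpow n z)%C (g z)) ->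
  forall z, is_Cderive f z (g z).
Proof.
  intros HM HL HA Hf Hg z. apply is_derive_C_eps. intros eps He.
  set (rho := Cmod z + 1).
  assert (R0 : 0 <= rho) by (unfold rho; pose proof (Cmod_ge_0 z); lra).
  set (B := 2 * (M * L ^ 2 * exp (2 * (L * rho)))).
  assert (HB : 0 <= B).
  { unfold B. pose proof (exp_pos (2 * (L * rho))). pose proof (pow_le L 2 HL).
    repeat apply Rmult_le_pos; lra. }
  assert (Hq : 0 < eps / (1 + B)) by (apply Rdiv_lt_0_compat; lra).
  exists (Rmin 1 (eps / (1 + B))). split; [apply Rmin_pos; lra|].
  intros w Hw.
  assert (Hw1 := Rlt_le_trans _ _ _ Hw (Rmin_l _ _)).
  assert (Hw2 := Rlt_le_trans _ _ _ Hw (Rmin_r _ _)).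
  set (h := (w - z)%C) in *.
  assert (Ew : w = (z + h)%C) by (unfold h; ring).
  (* The termwise difference [f w - f z - h * g z]; the series of [g] is delayed by one
     index to match the orders. *)
  set (E := fun n => ((A n * dpow n w + (-1) * (A n * dpow n z))
     + (-1) * (h * match n with O => 0 | S k => A n * dpow k z end))%C).
  assert (HE : is_Cseries E (f w - f z - h * g z)%C).
  { replace (f w - f z - h * g z)%C with ((f w + (-1) * f z) + (-1) * (h * g z))%C by ring.
    apply (is_Cseries_plus (fun n => (A n * dpow n w + (-1) * (A n * dpow n z))%C)).
    - apply is_Cseries_plus; [apply Hf|]. apply is_Cseries_scal, Hf.
    - apply is_Cseries_scal, is_Cseries_scal.
      apply (is_series_decr_1 (K := C_AbsRing) (V := C_NormedModule)).
      change (plus (g z) (opp (RtoC 0))) with (g z + - 0)%C.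
      replace (g z + - 0)%C with (g z) by ring. apply Hg. }
  assert (E0 : csum E 2 = RtoC 0).
  { simpl. unfold E, dpow. simpl. rewrite Ew. field. }
  apply (is_Cseries_shift _ _ 2) in HE. rewrite E0 in HE.
  assert (Hrem : forall k, Cmod (E (2 + k)%nat)
            <= (Cmod h * Cmod h * (M * L ^ 2 * exp (2 * (L * rho)))) * (1/2) ^ k).
  { intros k.
    assert (Nk := fact_C_neq_0 k).
    assert (N1 := INR_C_neq_0 (S k) ltac:(discriminate)).
    assert (N2 := INR_C_neq_0 (S (S k)) ltac:(discriminate)).
    assert (EE : E (2 + k)%nat = (A (S (S k)) *
       (((z + h) ^ S (S k) - z ^ S (S k) - RtoC (INR (S (S k))) * h * z ^ S k)
         / (RtoC (INR (S (S k))) * (RtoC (INR (S k)) * RtoC (INR (fact k))))))%C).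
    { change (2 + k)%nat with (S (S k)). unfold E, dpow.
        rewrite (fact_C_S (S k)), (fact_C_S k), <- Ew.
      field. auto. }
    rewrite EE, Cmod_mult, Cmod_div by (repeat apply Cmult_neq_0; assumption).
    rewrite !Cmod_mult, !Cmod_R, !(Rabs_right (INR _)) by (apply Rle_ge, pos_INR).
    assert (P0 := INR_fact_lt_0 k).
    assert (P1 : 0 < INR (S k)) by (apply lt_0_INR; lia).
    assert (P2 : 0 < INR (S (S k))) by (apply lt_0_INR; lia).
    assert (Hzr : Cmod z <= rho) by (unfold rho; lra).
    assert (Hzh : Cmod (z + h) <= rho).
    { eapply Rle_trans; [apply Cmod_triangle|]. unfold rho. lra. }
    pose proof (pow_remainder_le z h rho k Hzr Hzh) as HR.
    assert (HLr : 0 <= L * rho) by (apply Rmult_le_pos; assumption).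
    pose proof (pow_fact_le_half (L * rho) k HLr) as HF.
    rewrite Rpow_mult_distr in HF.
    pose proof (Cmod_ge_0 h) as Hh0.
    assert (Hhh : 0 <= Cmod h * Cmod h) by (apply Rmult_le_pos; lra).
    eapply Rle_trans.
    { apply Rmult_le_compat; [apply Cmod_ge_0| |apply HA|].
      - apply Rdiv_le_0_compat; [apply Cmod_ge_0|]. repeat apply Rmult_lt_0_compat; assumption.
      - apply Rmult_le_compat_r; [|exact HR].
        left. apply Rinv_0_lt_compat. repeat apply Rmult_lt_0_compat; assumption. }
    replace (M * L ^ S (S k) * (INR (S (S k)) * INR (S k) * (Cmod h * Cmod h) * rho ^ k *
       / (INR (S (S k)) * (INR (S k) * INR (fact k)))))
      with (Cmod h * Cmod h * (M * L ^ 2) * (L ^ k * rho ^ k / INR (fact k)))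
      by (change (L ^ S (S k)) with (L * (L * L ^ k)); field; lra).
    replace (Cmod h * Cmod h * (M * L ^ 2 * exp (2 * (L * rho))) * (1 / 2) ^ k)
      with (Cmod h * Cmod h * (M * L ^ 2) * (exp (2 * (L * rho)) * (1 / 2) ^ k)) by ring.
    apply Rmult_le_compat_l; [|exact HF].
    pose proof (pow_le L 2 HL). apply Rmult_le_pos; [exact Hhh|apply Rmult_le_pos; assumption]. }
  pose proof (geometric_tail _ _ _ Hrem HE O) as HF. simpl csum in HF.
  replace (f w - f z - h * g z - 0 - 0)%C with (f w - f z - h * g z)%C in HF by ring.
  eapply Rle_trans; [exact HF|].
  replace (2 * (Cmod h * Cmod h * (M * L ^ 2 * exp (2 * (L * rho)))) * (1 / 2) ^ 0)
    with (Cmod h * B * Cmod h) by (unfold B; simpl; ring).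
  apply Rmult_le_compat_r; [apply Cmod_ge_0|].
  apply Rle_trans with (eps / (1 + B) * (1 + B)).
  - apply Rmult_le_compat; try lra. apply Cmod_ge_0.
  - right. field. lra.
Qed.

Lemma C_derive_ext (f g : C -> C) (z : C) : (forall w, f w = g w) -> C_derive f z = C_derive g z.
Proof.
  intros H. replace g with f; [reflexivity|].
  apply functional_extensionality. exact H.
Qed.

(** Iterating termwise differentiation identifies the coefficients of the power
    series with the derivatives at [0]; the growth bound is stable under dropping
    initial coefficients, so it applies to all the derivatives. *)
Lemma entire_taylor (f : C -> C) (M K : R) :
  entire f -> 0 <= M -> (forall z, Cmod (f z) <= M * exp (K * Cmod z)) ->
  (forall n, Cmod (C_derive_n f n 0) <= M * exp K ^ n) /\
  (forall p, entire (C_derive_n f p)) /\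
  forall p z, is_Cseries
    (fun n => C_derive_n f (p + n) 0 * dpow n z)%C (C_derive_n f p z).
Proof.
  intros Hf HM Hexp.
  destruct (entire_power_series f M K Hf HM Hexp) as [A [HA Hs]].
  pose proof (exp_pos K) as HK.
  assert (HAp : forall p n, Cmod (A (p + n)%nat) <= (M * exp K ^ p) * exp K ^ n).
  { intros p n. rewrite Rmult_assoc, <- pow_add. apply HA. }
  assert (HM' : forall p, 0 <= M * exp K ^ p).
  { intros p. apply Rmult_le_pos; [exact HM|]. apply pow_le. lra. }
  assert (Hser : forall p z, is_Cseries
     (fun n => A (p + n)%nat * dpow n z)%C (C_derive_n f p z) /\
     is_Cderive (C_derive_n f p) z (C_derive_n f (S p) z)).
  { assert (Hd : forall p,
     (forall z, is_Cseries (fun n => A (p + n)%nat * dpow n z)%C (C_derive_n f p z)) ->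
     (forall z, is_Cseries (fun n => A (S p + n)%nat * dpow n z)%C (C_derive_n f (S p) z)) /\
     forall z, is_Cderive (C_derive_n f p) z (C_derive_n f (S p) z)).
    { intros p Hp.
      destruct (choice (fun z l => is_Cseries
        (fun n => A (S p + n)%nat * dpow n z)%C l)) as [g Hg].
      { intros z. apply (geometric_series _ (M * exp K ^ S p * exp (2 * (exp K * Cmod z)))).
        intros n. apply (taylor_term_le (fun n => A (S p + n)%nat)); [apply HM'|lra|apply HAp]. }
      assert (HD : forall z, is_Cderive (C_derive_n f p) z (g z)).
      { apply (power_series_derive (fun n => A (p + n)%nat) (M * exp K ^ p) (exp K)); auto.
        - lra.
        - intros z. refine (is_Cseries_ext _ _ _ _ (Hg z)).
          intros n. replace (p + S n)%nat with (S p + n)%nat by lia. reflexivity. }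
      assert (Eg : forall z, C_derive_n f (S p) z = g z)
        by (intros z; apply is_C_derive_unique, HD).
      split; intros z; rewrite Eg; auto. }
    assert (Hall : forall p z, is_Cseries
     (fun n => A (p + n)%nat * dpow n z)%C (C_derive_n f p z)).
    { induction p as [|p IH]; [exact Hs|]. apply Hd, IH. }
    intros p z. split; [apply Hall|]. apply Hd, Hall. }
  assert (EA : forall n, C_derive_n f n 0 = A n).
  { intros n. apply (is_series_C_unique _ _ _ (proj1 (Hser n (RtoC 0)))).
    apply (is_series_decr_1 (K := C_AbsRing) (V := C_NormedModule)).
    assert (Z : is_Cseries (fun _ => RtoC 0) (RtoC 0)).
    { refine (is_Cseries_ext _ _ _ _ (is_Cseries_single 0)). intros [|m]; reflexivity. }
    assert (T0 : plus (A n) (opp (A (n + 0)%nat * dpow 0 0)%C) = RtoC 0).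
    { rewrite Nat.add_0_r, dpow_0. change ((A n + - (A n * 1))%C = RtoC 0). ring. }
    refine (eq_ind_r (fun l => is_Cseries _ l) _ T0).
    refine (is_Cseries_ext _ _ _ _ Z). intros k. unfold dpow. rewrite Cpow_S.
    unfold Cdiv. ring. }
  split; [|split].
  - intros n. rewrite EA. apply HA.
  - intros p z. exists (C_derive_n f (S p) z). apply Hser.
  - intros p z. refine (is_Cseries_ext _ _ _ _ (proj1 (Hser p z))).
    intros n. rewrite EA. reflexivity.
Qed.

(** * Divided powers and finite differences *)

Lemma Cmult_cancel (c a b : C) : c <> 0 -> (c * a)%C = (c * b)%C -> a = b.
Proof.
  intros Hc H. apply (f_equal (Cmult (/ c))) in H.
  rewrite !Cmult_assoc, Cinv_l, !Cmult_1_l in H by exact Hc. exact H.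
Qed.

(** A weighted convolution that contains both expansions needed here.  For [g = 1]
    it is the binomial expansion of [dpow d (a + b)]; for [a = 1] and [b = -1] it is
    the [d]-th finite difference of [g] at [0], divided by [d!]. *)
Definition dconv (d : nat) (a b : C) (g : nat -> C) : C :=
  csum (fun p => dpow p a * dpow (d - p) b * g p)%C (S d).

(** The factor [d + 1] is split as [p + (d + 1 - p)] in each term, and either part
    lowers the index of one divided power. *)
Lemma dconv_S (d : nat) (a b : C) (g : nat -> C) :
  (RtoC (INR (S d)) * dconv (S d) a b g)%C
  = (a * dconv d a b (fun p => g (S p)) + b * dconv d a b g)%C.
Proof.
  unfold dconv at 1. rewrite <- csum_scal.
  rewrite (csum_ext _ (fun p =>
    RtoC (INR p) * dpow p a * dpow (S d - p) b * g p
    + dpow p a * (RtoC (INR (S d - p)) * dpow (S d - p) b) * g p)%C).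
  2:{ intros p Hp. replace (S d) with (p + (S d - p))%nat at 1 by lia.
      rewrite INR_C_add. ring. }
  rewrite csum_plus. f_equal.
  - rewrite csum_shift. unfold dconv. rewrite <- csum_scal.
    simpl INR at 1.
    replace (RtoC 0 * dpow 0 a * dpow (S d - 0) b * g 0%nat)%C with (RtoC 0) by ring.
    rewrite Cplus_0_l. apply csum_ext. intros p Hp.
    rewrite dpow_S. simpl Nat.sub. ring.
  - unfold dconv. rewrite <- csum_scal.
    match goal with |- csum ?F (S (S d)) = _ =>
      change (csum F (S (S d))) with (csum F (S d) + F (S d))%C end.
    cbv beta. rewrite Nat.sub_diag. simpl INR at 2.
    replace (dpow (S d) a * (RtoC 0 * dpow 0 b) * g (S d))%C with (RtoC 0) by ring.
    rewrite Cplus_0_r. apply csum_ext. intros p Hp.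
    replace (S d - p)%nat with (S (d - p)) by lia. rewrite dpow_S. ring.
Qed.

Lemma dpow_plus (d : nat) (a b : C) :
  dpow d (a + b) = csum (fun j => dpow j a * dpow (d - j) b)%C (S d).
Proof.
  transitivity (dconv d a b (fun _ => RtoC 1)).
  2: apply csum_ext; intros; ring.
  induction d as [|d IH].
  - unfold dconv. simpl. rewrite !dpow_0. ring.
  - assert (N := INR_C_neq_0 (S d) ltac:(discriminate)).
    assert (E : (RtoC (INR (S d)) * dpow (S d) (a + b))%C
      = (RtoC (INR (S d)) * dconv (S d) a b (fun _ => RtoC 1))%C).
    { rewrite dpow_S, dconv_S, IH. ring. }
    exact (Cmult_cancel _ _ _ N E).
Qed.

(** Polynomial sequences of degree less than [d], recognised by the vanishing of
    their [d]-th differences. *)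
Fixpoint degree_lt (d : nat) (g : nat -> C) : Prop :=
  match d with
  | O => forall k, g k = RtoC 0
  | S e => degree_lt e (fun k => g (S k) - g k)%C
  end.

Lemma degree_lt_ext (d : nat) (g h : nat -> C) :
  (forall k, g k = h k) -> degree_lt d g -> degree_lt d h.
Proof.
  revert g h. induction d as [|d IH]; simpl; intros g h E H.
  - intros k. rewrite <- E. apply H.
  - refine (IH _ _ _ H). intros k. rewrite !E. reflexivity.
Qed.

Lemma degree_lt_plus (d : nat) (g h : nat -> C) :
  degree_lt d g -> degree_lt d h -> degree_lt d (fun k => g k + h k)%C.
Proof.
  revert g h. induction d as [|d IH]; simpl; intros g h Hg Hh.
  - intros k. rewrite Hg, Hh. ring.
  - refine (degree_lt_ext _ _ _ _ (IH _ _ Hg Hh)). intros k. cbv beta. ring.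
Qed.

Lemma degree_lt_shift (d : nat) (g : nat -> C) :
  degree_lt d g -> degree_lt d (fun k => g (S k)).
Proof.
  revert g. induction d as [|d IH]; simpl; intros g H.
  - intros k. apply H.
  - exact (IH _ H).
Qed.

(** By the Leibniz rule, the difference of [(k + c) g(k)] is
    [(k + c) (g(k + 1) - g(k)) + g(k + 1)]. *)
Lemma degree_lt_mul_linear (d : nat) (c : C) (g : nat -> C) :
  degree_lt d g -> degree_lt (S d) (fun k => (RtoC (INR k) + c) * g k)%C.
Proof.
  revert g. induction d as [|d IH]; intros g H.
  - simpl in *. intros k. rewrite !H. ring.
  - change (degree_lt (S d) (fun k =>
      (RtoC (INR (S k)) + c) * g (S k) - (RtoC (INR k) + c) * g k)%C).
    apply (degree_lt_ext _
      (fun k => (RtoC (INR k) + c) * (g (S k) - g k) + g (S k))%C).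
    + intros k. rewrite INR_C_S. ring.
    + apply degree_lt_plus; [exact (IH _ H)|apply degree_lt_shift, H].
Qed.

Lemma degree_lt_pow (n d : nat) (c : C) (g : nat -> C) :
  degree_lt d g -> degree_lt (n + d) (fun k => (RtoC (INR k) + c) ^ n * g k)%C.
Proof.
  intros H. induction n as [|n IH].
  - refine (degree_lt_ext _ _ _ _ H). intros k. simpl. ring.
  - refine (degree_lt_ext _ _ _ _ (degree_lt_mul_linear _ c _ IH)).
    intros k. rewrite Cpow_S. ring.
Qed.

Lemma degree_lt_1 : degree_lt 1 (fun _ => RtoC 1).
Proof. simpl. intros k. ring. Qed.

(** The recursion of [dconv] turns a difference of order [d + 1] of [g] into one of
    order [d] of the increments of [g]. *)
Lemma difference_vanishes (d : nat) (g : nat -> C) :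
  degree_lt d g -> dconv d (RtoC 1) (RtoC (-1)) g = RtoC 0.
Proof.
  revert g. induction d as [|d IH]; intros g H.
  - unfold dconv. simpl in *. rewrite H. ring.
  - assert (N := INR_C_neq_0 (S d) ltac:(discriminate)).
    assert (E : (RtoC (INR (S d)) * dconv (S d) (RtoC 1) (RtoC (-1)) g)%C = RtoC 0).
    { rewrite dconv_S, <- (IH _ H). unfold dconv.
      rewrite <- !csum_scal, <- csum_plus. apply csum_ext. intros p _. ring. }
    apply (Cmult_cancel _ _ _ N). rewrite E. ring.
Qed.

Lemma Cpow_opp (a : C) (n : nat) : ((- a) ^ n)%C = (RtoC (-1) ^ n * a ^ n)%C.
Proof. rewrite <- Cpow_mult_l. f_equal. ring. Qed.

Lemma sign_double (n k : nat) : (k <= n)%nat ->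
  (RtoC (-1) ^ k)%C = (RtoC (-1) ^ n * RtoC (-1) ^ (n - k))%C.
Proof.
  intros H. rewrite <- Cpow_add_r. replace (n + (n - k))%nat with (k + 2 * (n - k))%nat by lia.
  rewrite Cpow_add_r, Cpow_mult_r.
  replace (RtoC (-1) ^ 2)%C with (RtoC 1) by (simpl; ring). rewrite Cpow_1_l. ring.
Qed.

(** With [t = i + c], the [i]-th term is [x ^ (d + 1)] times [t ^ d] times the signed
    binomial weight: the factor [1 / t] lowers the degree just below the order of the
    difference. *)
Lemma shifted_difference (d : nat) (c x : C) :
  (forall i, (RtoC (INR i) + c)%C <> 0) ->
  csum (fun i => 1 / (RtoC (INR i) + c) * dpow i ((RtoC (INR i) + c) * x)
                 * dpow (S d - i) (- ((RtoC (INR i) + c) * x)))%C (S (S d)) = RtoC 0.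
Proof.
  intros Hc.
  transitivity (x ^ S d * dconv (S d) (RtoC 1) (RtoC (-1))
      (fun k => (RtoC (INR k) + c) ^ d * 1)%C)%C.
  - unfold dconv. rewrite <- csum_scal. apply csum_ext. intros i Hi.
    unfold dpow. rewrite Cpow_1_l, Cpow_opp, !Cpow_mult_l.
    replace ((RtoC (INR i) + c) ^ d)%C
      with (1 / (RtoC (INR i) + c) * ((RtoC (INR i) + c) ^ i * (RtoC (INR i) + c) ^ (S d - i)))%C.
    2:{ rewrite <- Cpow_add_r. replace (i + (S d - i))%nat with (S d) by lia.
        rewrite Cpow_S. field. apply Hc. }
    replace (x ^ S d)%C with (x ^ i * x ^ (S d - i))%C
      by (rewrite <- Cpow_add_r; f_equal; lia).
    field. repeat split; try apply fact_C_neq_0. apply Hc.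
  - rewrite difference_vanishes; [ring|].
    replace (S d) with (d + 1)%nat by lia. apply degree_lt_pow, degree_lt_1.
Qed.

(** [q!] times the binomial coefficient of [k - 1] over [q], as a polynomial in [k]. *)
Fixpoint falling (q : nat) (k : nat) : C :=
  match q with
  | O => 1
  | S r => ((RtoC (INR k) - RtoC (INR (S r))) * falling r k)%C
  end.

Lemma falling_zero (q k : nat) : (1 <= k <= q)%nat -> falling q k = RtoC 0.
Proof.
  induction q as [|q IH]; intros H; [lia|]. cbn [falling].
  destruct (Nat.eq_dec k (S q)) as [->|Hk]; [ring|]. rewrite IH by lia. ring.
Qed.

Lemma falling_fact (q k : nat) :
  falling q (S q + k) = (RtoC (INR (fact (q + k))) / RtoC (INR (fact k)))%C.
Proof.
  revert k. induction q as [|q IH]; intros k.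
  - simpl. field. apply fact_C_neq_0.
  - cbn [falling]. replace (S (S q) + k)%nat with (S q + S k)%nat by lia.
    rewrite IH. replace (S q + k)%nat with (q + S k)%nat by lia.
    rewrite (INR_C_add (S q) (S k)), (fact_C_S k). field. nonzero.
Qed.

Lemma degree_lt_falling (q : nat) : degree_lt (q + 1) (falling q).
Proof.
  induction q as [|q IH]; [apply degree_lt_1|].
  refine (degree_lt_ext _ _ _ _ (degree_lt_mul_linear _ (- RtoC (INR (S q))) _ IH)).
  intros k. reflexivity.
Qed.

(** With [p = q + 1 + k] and [N = q + 1 + d] this is, up to sign and [N!], the [N]-th
    difference of the polynomial [p ^ d (p - 1) ... (p - q)] of degree [N - 1].  The
    terms [p <= q] that are absent from the sum vanish: for [p >= 1] because of the
    falling product, and for [p = 0] because [d > 0]. *)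
Lemma abel_coefficient (q d : nat) :
  csum (fun k => RtoC (INR (fact (q + k))) / (RtoC (INR (fact k)) * RtoC (INR (fact (S q + k))))
     * dpow (d - k) 1 * (RtoC (-1) ^ k * RtoC (INR (S q + k)) ^ d))%C (S d)
  = match d with O => (1 / RtoC (INR (S q)))%C | S _ => RtoC 0 end.
Proof.
  destruct d as [|d].
  - cbn [csum]. rewrite !Nat.add_0_r, fact_C_S, dpow_0.
    change (RtoC (INR (fact 0))) with (RtoC 1). cbn [Cpow]. field. nonzero.
  - set (N := (S q + S d)%nat).
    assert (H : dconv N (RtoC 1) (RtoC (-1))
        (fun p => (RtoC (INR p) + 0) ^ S d * falling q p)%C = RtoC 0).
    { apply difference_vanishes. replace N with (S d + (q + 1))%nat by (unfold N; lia).
      apply degree_lt_pow, degree_lt_falling. }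
    unfold dconv in H. replace (S N) with (S q + S (S d))%nat in H by (unfold N; lia).
    rewrite csum_split, csum_zero, Cplus_0_l in H.
    2:{ intros [|p] Hp.
        - rewrite Cplus_0_r. simpl (INR 0). rewrite Cpow_S. ring.
        - rewrite falling_zero by lia. ring. }
    (* The factor (-1)^d reconciles the signs (-1)^k and (-1)^(N - p). *)
    apply (f_equal (Cmult (RtoC (-1) ^ S d))) in H. rewrite <- csum_scal, Cmult_0_r in H.
    rewrite <- H. apply csum_ext. intros k Hk.
    rewrite falling_fact, Cplus_0_r. unfold dpow. rewrite !Cpow_1_l.
    replace (N - (S q + k))%nat with (S d - k)%nat by (unfold N; lia).
    rewrite (sign_double (S d) k) by lia.
    field. repeat split; apply fact_C_neq_0.
Qed.

(** * Rearrangement along total order and the three identities *)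

Lemma C_derive_n_translate (f : C -> C) (y : C) (p : nat) (z : C) :
  (forall p, entire (C_derive_n f p)) ->
  C_derive_n (fun w => f (y + w)%C) p z = C_derive_n f p (y + z)%C.
Proof.
  intros H. revert z. induction p as [|p IH]; intros z; [reflexivity|].
  cbn [C_derive_n].
  rewrite (C_derive_ext _ (fun w => C_derive_n f p (y + w)%C) z IH).
  apply is_C_derive_unique.
  pose proof (C_derive_correct (C_derive_n f p) (y + z)%C 0%C (H p (y + z)%C)) as HD.
  rewrite is_derive_C_eps in HD. apply is_derive_C_eps. intros eps He.
  destruct (HD eps He) as [d [Hd Hw]]. exists d. split; [exact Hd|].
  intros w Hwz. specialize (Hw (y + w)%C).
  replace (y + w - (y + z))%C with (w - z)%C in Hw by ring. exact (Hw Hwz).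
Qed.

Lemma entire_translate (f : C -> C) (y : C) : entire f -> entire (fun w => f (y + w)%C).
Proof.
  intros H z. destruct (H (y + z)%C) as [l Hl]. exists l.
  rewrite is_derive_C_eps in Hl. apply is_derive_C_eps. intros eps He.
  destruct (Hl eps He) as [d [Hd Hw]]. exists d. split; [exact Hd|].
  intros w Hwz. specialize (Hw (y + w)%C).
  replace (y + w - (y + z))%C with (w - z)%C in Hw by ring. exact (Hw Hwz).
Qed.

Lemma exp_INR_le (p : nat) : exp (INR p) <= 3 ^ p.
Proof.
  induction p as [|p IH].
  - simpl. rewrite exp_0. lra.
  - rewrite S_INR, exp_plus. simpl. pose proof exp_le_3. pose proof (exp_pos 1).
    pose proof (exp_pos (INR p)). rewrite Rmult_comm. apply Rmult_le_compat; lra.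
Qed.

(** Since [t ^ p / p! <= exp t], the growth [p ^ p / p!] is at most [exp p], hence at
    most [3 ^ p]. *)
Lemma pow_affine_le (be r : R) (p : nat) : 0 <= be -> 0 < r ->
  (be + INR p * r) ^ p / INR (fact p) <= exp (be / r) * (3 * r) ^ p.
Proof.
  intros Hb Hr. pose proof (pos_INR p) as Hp. pose proof (INR_fact_lt_0 p).
  assert (Hbr : 0 <= be / r) by (apply Rdiv_le_0_compat; lra).
  replace (be + INR p * r) with ((be / r + INR p) * r) by (field; lra).
  rewrite !Rpow_mult_distr.
  pose proof (pow_fact_le_exp (be / r + INR p) p ltac:(lra)) as H1.
  rewrite exp_plus in H1. pose proof (exp_INR_le p) as H2.
  pose proof (exp_pos (be / r)). pose proof (pow_lt r p Hr).
  replace ((be / r + INR p) ^ p * r ^ p / INR (fact p))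
    with ((be / r + INR p) ^ p / INR (fact p) * r ^ p) by (field; lra).
  rewrite <- Rmult_assoc. apply Rmult_le_compat_r; [lra|].
  eapply Rle_trans; [exact H1|]. apply Rmult_le_compat_l; lra.
Qed.

(** The common mechanism of the three identities.  Expanding each
    [C_derive_n f p (w p)] at [0] gives a double series; the factor [1/6] in the decay
    of the [g p] absorbs the growth [3 ^ p] of [exp (2 * L * Cmod (w p))], so that the
    double series is dominated by a multiple of [2 ^ -(p + n)] and can be summed by
    total order. *)
Lemma taylor_rearrangement (f : C -> C) (M L G al : R) (g w : nat -> C) :
  0 <= M -> 0 <= L ->
  (forall n, Cmod (C_derive_n f n 0) <= M * L ^ n) ->
  (forall p z, is_Cseries (fun n => C_derive_n f (p + n) 0 * dpow n z)%C (C_derive_n f p z)) ->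
  (forall p, Cmod (g p) * L ^ p <= G * (1/6) ^ p) ->
  (forall p, L * Cmod (w p) <= al + INR p / 2) ->
  exists s : C,
    is_Cseries (fun p => g p * C_derive_n f p (w p))%C s /\
    is_Cseries (fun N => C_derive_n f N 0
       * csum (fun p => g p * dpow (N - p) (w p)) (S N))%C s.
Proof.
  intros HM HL HA HT Hg Hw.
  destruct (double_series_diagonal
    (fun p n => g p * (C_derive_n f (p + n) 0 * dpow n (w p)))%C
    (fun p => g p * C_derive_n f p (w p))%C (G * M * exp (2 * al))) as [s [H1 H2]].
  - intros p n. rewrite Cmod_mult.
    pose proof (taylor_term_le (fun n => C_derive_n f (p + n) 0) (M * L ^ p) L (w p) n) as HB.
    cbv beta in HB. pose proof (pow_le L p HL) as HLp.
    assert (HB' := HB ltac:(apply Rmult_le_pos; assumption) HL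
      ltac:(intros k; rewrite Rmult_assoc, <- pow_add; apply HA)).
    clear HB.
    eapply Rle_trans; [apply Rmult_le_compat_l; [apply Cmod_ge_0|exact HB']|].
    pose proof (half_pow_pos n). rewrite <- Rmult_assoc.
    apply Rmult_le_compat_r; [lra|].
    assert (E1 : exp (2 * (L * Cmod (w p))) <= exp (2 * al) * 3 ^ p).
    { apply Rle_trans with (exp (2 * al + INR p)).
      - apply exp_monotone. specialize (Hw p). lra.
      - rewrite exp_plus. apply Rmult_le_compat_l; [left; apply exp_pos|apply exp_INR_le]. }
    replace (Cmod (g p) * (M * L ^ p * exp (2 * (L * Cmod (w p)))))
      with (Cmod (g p) * L ^ p * (M * exp (2 * (L * Cmod (w p))))) by ring.
    replace (G * M * exp (2 * al) * (1 / 2) ^ p)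
      with (G * (1/6) ^ p * (M * (exp (2 * al) * 3 ^ p))).
    2:{ replace (1/2) with (1/6 * 3) by lra. rewrite Rpow_mult_distr. ring. }
    apply Rmult_le_compat.
    + apply Rmult_le_pos; [apply Cmod_ge_0|exact HLp].
    + apply Rmult_le_pos; [exact HM|left; apply exp_pos].
    + apply Hg.
    + apply Rmult_le_compat_l; assumption.
  - intros p. apply is_Cseries_scal, HT.
  - exists s. split; [exact H1|]. refine (is_Cseries_ext _ _ _ _ H2).
    intros N. cbv beta. rewrite <- csum_scal. apply csum_ext. intros p Hp.
    replace (p + (N - p))%nat with N by lia. ring.
Qed.

(** After the binomial expansion of [dpow p (z + (p + la) x)], the coefficient of
    [dpow j z] is a difference of order [N - j] of a polynomial of degree [N - j - 1],
    so only [j = N] remains. *)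
Lemma shifted_sum_coefficient (N : nat) (z x la : C) : (forall n, (RtoC (INR n) + la)%C <> 0) ->
  csum (fun p => 1 / (RtoC (INR p) + la) * dpow p (z + (RtoC (INR p) + la) * x)
     * dpow (N - p) (- ((RtoC (INR p) + la) * x)))%C (S N)
  = (1 / (RtoC (INR N) + la) * dpow N z)%C.
Proof.
  intros Hla.
  (* [T j i] is the term of index [j] in the expansion of the term [p = i + j]. *)
  set (T := fun j i => (dpow j z * (1 / (RtoC (INR i) + (RtoC (INR j) + la))
    * dpow i ((RtoC (INR i) + (RtoC (INR j) + la)) * x)
    * dpow (N - j - i) (- ((RtoC (INR i) + (RtoC (INR j) + la)) * x))))%C).
  transitivity (csum (fun n => csum (fun p => T p (n - p)%nat) (S n)) (S N)).
  - apply csum_ext. intros p Hp. rewrite dpow_plus.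
    rewrite <- csum_scal, Cmult_comm, <- csum_scal. apply csum_ext. intros j Hj.
    unfold T.
    assert (E : (RtoC (INR (p - j)) + (RtoC (INR j) + la))%C = (RtoC (INR p) + la)%C).
    { rewrite Cplus_assoc, <- INR_C_add. do 3 f_equal. lia. }
    rewrite E. replace (N - j - (p - j))%nat with (N - p)%nat by lia. ring.
  - rewrite csum_triangle.
    change (csum (fun p => csum (T p) (S N - p)) (S N))
      with (csum (fun p => csum (T p) (S N - p)) N + csum (T N) (S N - N))%C.
    rewrite csum_zero, Cplus_0_l.
    + replace (S N - N)%nat with 1%nat by lia. cbn [csum]. unfold T.
      replace (N - N - 0)%nat with 0%nat by lia. rewrite !dpow_0.
      change (INR 0) with 0. rewrite !Cplus_0_l. field. apply Hla.
    + intros j Hj. unfold T. rewrite csum_scal.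
      replace (S N - j)%nat with (S (N - j)) by lia.
      destruct (N - j)%nat as [|e] eqn:He; [lia|].
      rewrite shifted_difference; [ring|].
      intros i. rewrite Cplus_assoc, <- INR_C_add. apply Hla.
Qed.

(** A form of Abel's binomial identity.  The powers of [la - p] are expanded in
    [la], and [abel_coefficient] kills every power of [la] except the highest. *)
Lemma abel_sum (n : nat) (x la : C) :
  csum (fun q => (la - RtoC (INR (S q))) ^ q * dpow (S q) x
     * dpow (n - q) (RtoC (INR (S q)) * x))%C (S n)
  = (la ^ n * dpow (S n) x)%C.
Proof.
  (* [T i k] is the term of index [i] in the expansion of the term [q = i + k]. *)
  set (T := fun i k => (x ^ S n * dpow i la *
    (RtoC (INR (fact (i + k))) / (RtoC (INR (fact k)) * RtoC (INR (fact (S i + k))))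
     * dpow (n - i - k) 1 * (RtoC (-1) ^ k * RtoC (INR (S i + k)) ^ (n - i))))%C).
  transitivity (csum (fun m => csum (fun p => T p (m - p)%nat) (S m)) (S n)).
  - apply csum_ext. intros q Hq.
    assert (E : ((la - RtoC (INR (S q))) ^ q)%C
      = (RtoC (INR (fact q)) * dpow q (la + - RtoC (INR (S q))))%C).
    { unfold dpow, Cminus. field. apply fact_C_neq_0. }
    rewrite E, dpow_plus, <- csum_scal.
    rewrite <- Cmult_assoc, Cmult_comm, <- csum_scal. apply csum_ext. intros i Hi.
    unfold T. replace (S i + (q - i))%nat with (S q) by lia.
    replace (i + (q - i))%nat with q by lia.
    replace (n - i - (q - i))%nat with (n - q)%nat by lia.
    unfold dpow. rewrite Cpow_opp, Cpow_1_l, Cpow_mult_l.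
    replace (x ^ S n)%C with (x ^ S q * x ^ (n - q))%C
      by (rewrite <- Cpow_add_r; f_equal; lia).
    replace (RtoC (INR (S q)) ^ (n - i))%C
      with (RtoC (INR (S q)) ^ (q - i) * RtoC (INR (S q)) ^ (n - q))%C
      by (rewrite <- Cpow_add_r; f_equal; lia).
    field. nonzero.
  - rewrite csum_triangle.
    change (csum (fun p => csum (T p) (S n - p)) (S n))
      with (csum (fun p => csum (T p) (S n - p)) n + csum (T n) (S n - n))%C.
    rewrite csum_zero, Cplus_0_l.
    + replace (S n - n)%nat with (S (n - n)) by lia. unfold T.
        rewrite csum_scal, abel_coefficient.
      rewrite Nat.sub_diag. unfold dpow. rewrite fact_C_S. field. nonzero.
    + intros i Hi. unfold T. rewrite csum_scal.
      replace (S n - i)%nat with (S (n - i)) by lia. rewrite abel_coefficient.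
      destruct (n - i)%nat eqn:He; [lia|ring].
Qed.

(** The powers of [p = q + 1 + k] from the two factors combine to [p ^ d], and
    the sum becomes that of [abel_coefficient]. *)
Lemma sampled_derivative_coefficient (q d : nat) (x : C) :
  csum (fun k => RtoC (Binomial.C (q + k) q)
     * (RtoC (-1) ^ k * RtoC (INR (S q + k)) ^ k / RtoC (INR (fact (S q + k)))) * x ^ k
     * dpow (d - k) (RtoC (INR (S q + k)) * x))%C (S d)
  = match d with O => (1 / RtoC (INR (fact (S q))))%C | S _ => RtoC 0 end.
Proof.
  transitivity (x ^ d / RtoC (INR (fact q)) *
    match d with O => 1 / RtoC (INR (S q)) | S _ => RtoC 0 end)%C.
  - rewrite <- abel_coefficient, <- csum_scal. apply csum_ext. intros k Hk.
    unfold Binomial.C. replace (q + k - q)%nat with k by lia.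
    assert (N : INR (fact q) * INR (fact k) <> 0)
      by (apply Rmult_integral_contrapositive_currified; apply INR_fact_neq_0).
    rewrite RtoC_div by exact N. rewrite RtoC_mult.
    unfold dpow. rewrite Cpow_1_l, Cpow_mult_l.
    replace (x ^ d)%C with (x ^ k * x ^ (d - k))%C by (rewrite <- Cpow_add_r; f_equal; lia).
    replace (RtoC (INR (S q + k)) ^ d)%C
      with (RtoC (INR (S q + k)) ^ k * RtoC (INR (S q + k)) ^ (d - k))%C
      by (rewrite <- Cpow_add_r; f_equal; lia).
    field. nonzero.
  - destruct d as [|d]; [|ring]. cbn [Cpow]. rewrite fact_C_S. field. nonzero.
Qed.

Lemma binomial_le (n k : nat) : (k <= n)%nat -> 0 <= Binomial.C n k <= 2 ^ n.
Proof.
  revert k. induction n as [|n IH]; intros k Hk.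
  - replace k with 0%nat by lia. unfold Binomial.C. simpl. lra.
  - destruct k as [|k].
    + unfold Binomial.C. rewrite Nat.sub_0_r. simpl (fact 0).
      pose proof (INR_fact_lt_0 (S n)).
      replace (INR (fact (S n)) / (INR 1 * INR (fact (S n)))) with 1 by (simpl (INR 1); field;
          lra).
      split; [lra|apply pow_R1_Rle; lra].
    + destruct (Nat.eq_dec k n) as [->|Hne].
      * unfold Binomial.C. rewrite Nat.sub_diag. simpl (fact 0).
        pose proof (INR_fact_lt_0 (S n)).
        replace (INR (fact (S n)) / (INR (fact (S n)) * INR 1)) with 1 by (simpl (INR 1); field;
            lra).
        split; [lra|apply pow_R1_Rle; lra].
      * rewrite <- pascal by lia. simpl pow.
        specialize (IH k ltac:(lia)) as H1. specialize (IH (S k) ltac:(lia)) as H2. lra.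
Qed.

(** The terms with [p > 1 + Cmod la] are at most [1], and the others are finite in
    number. *)
Lemma inverse_shift_bounded (la : C) : (forall n, (RtoC (INR n) + la)%C <> 0) ->
  exists B, 0 <= B /\ forall p, Cmod (1 / (RtoC (INR p) + la)) <= B.
Proof.
  intros Hla.
  assert (Hfin : forall P, exists B, 0 <= B /\ forall p, (p < P)%nat ->
      Cmod (1 / (RtoC (INR p) + la)) <= B).
  { induction P as [|P [B [HB H]]].
    - exists 0. split; [lra|]. intros p Hp. lia.
    - exists (B + Cmod (1 / (RtoC (INR P) + la))).
      pose proof (Cmod_ge_0 (1 / (RtoC (INR P) + la))). split; [lra|].
      intros p Hp. destruct (Nat.eq_dec p P) as [->|Hne]; [lra|].
      specialize (H p ltac:(lia)). lra. }
  destruct (INR_unbounded (1 + Cmod la)) as [P HP].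
  destruct (Hfin P) as [B [HB H]].
  exists (B + 1). split; [lra|]. intros p.
  destruct (Nat.lt_ge_cases p P) as [Hp|Hp]; [specialize (H p Hp); lra|].
  apply le_INR in Hp.
  rewrite Cmod_div by apply Hla. rewrite Cmod_1.
  pose proof (Cmod_triangle (RtoC (INR p) + la) (- la)) as HT.
  replace (RtoC (INR p) + la + - la)%C with (RtoC (INR p)) in HT by ring.
  rewrite Cmod_opp, Cmod_R, Rabs_right in HT by (apply Rle_ge, pos_INR).
  assert (/ Cmod (RtoC (INR p) + la) <= / 1) by (apply Rinv_le_contravar; lra).
  unfold Rdiv. lra.
Qed.

Lemma Cmod_INR (n : nat) : Cmod (RtoC (INR n)) = INR n.
Proof. rewrite Cmod_R. apply Rabs_right, Rle_ge, pos_INR. Qed.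

(** The rearrangement is applied to the translate of [f] by [y]; translation keeps
    the rate [K] of exponential growth, so the admissible [x] do not depend on [y]. *)
Lemma shifted_taylor_series (f : C -> C) (M K : R) :
  entire f -> 0 <= M -> (forall z, Cmod (f z) <= M * exp (K * Cmod z)) -> 0 <= K ->
  forall x y z la : C, exp K * Cmod x <= 1/36 ->
  (forall n, (RtoC (INR n) + la)%C <> 0) ->
  exists s : C,
    is_Cseries (fun p => 1 / (RtoC (INR p) + la) * dpow p (z + (RtoC (INR p) + la) * x)
       * C_derive_n f p (y - (RtoC (INR p) + la) * x))%C s /\
    is_Cseries (fun p => 1 / (RtoC (INR p) + la) * dpow p z * C_derive_n f p y)%C s.
Proof.
  intros Hf HM Hexp HK x y z la Hx Hla.
  set (fy := fun w => f (y + w)%C).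
  set (L := exp K) in *. assert (HL : 0 < L) by apply exp_pos.
  assert (Hfy : forall w, Cmod (fy w) <= (M * exp (K * Cmod y)) * exp (K * Cmod w)).
  { intros w. eapply Rle_trans; [apply Hexp|]. rewrite Rmult_assoc, <- exp_plus.
    apply Rmult_le_compat_l; [exact HM|].
    pose proof (Cmod_triangle y w).
    apply exp_monotone. nra. }
  destruct (entire_taylor f M K Hf HM Hexp) as [_ [Hent _]].
  assert (HMy : 0 <= M * exp (K * Cmod y))
    by (apply Rmult_le_pos; [exact HM|left; apply exp_pos]).
  destruct (entire_taylor fy _ K (entire_translate f y Hf) HMy Hfy) as [HA [_ HT]].
  assert (Ey : forall p w, C_derive_n fy p w = C_derive_n f p (y + w)%C)
    by (intros p w; apply C_derive_n_translate, Hent).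
  destruct (inverse_shift_bounded la Hla) as [B [HB HBp]].
  pose proof (Cmod_ge_0 z) as Hz0. pose proof (Cmod_ge_0 la) as Hla0.
  pose proof (Cmod_ge_0 x) as Hx0.
  assert (HLz : 0 <= L * Cmod z) by (apply Rmult_le_pos; lra).
  set (be := L * Cmod z + Cmod la / 36).
  assert (Hpl : forall p, Cmod (RtoC (INR p) + la) <= INR p + Cmod la).
  { intros p. eapply Rle_trans; [apply Cmod_triangle|]. rewrite Cmod_INR. lra. }
  destruct (taylor_rearrangement fy (M * exp (K * Cmod y)) L (B * exp (be / (1/36))) (Cmod la)
    (fun p => 1 / (RtoC (INR p) + la) * dpow p (z + (RtoC (INR p) + la) * x))%C
    (fun p => - ((RtoC (INR p) + la) * x))%C) as [s [H1 H2]].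
  - exact HMy.
  - lra.
  - exact HA.
  - exact HT.
  - intros p. rewrite Cmod_mult, !Rmult_assoc.
    apply Rmult_le_compat; [apply Cmod_ge_0| |apply HBp|].
    { apply Rmult_le_pos; [apply Cmod_ge_0|apply pow_le; lra]. }
    eapply Rle_trans; [|apply Rmult_le_compat_l; [left; apply exp_pos|
        apply (pow_incr (1/12) (1/6)); lra]].
    replace (1/12) with (3 * (1/36)) by lra.
    eapply Rle_trans; [|apply pow_affine_le; unfold be; lra].
    unfold dpow. rewrite Cmod_div, Cmod_pow, Cmod_INR by apply fact_C_neq_0.
    pose proof (INR_fact_lt_0 p).
    replace (Cmod (z + (RtoC (INR p) + la) * x) ^ p / INR (fact p) * L ^ p)
      with ((Cmod (z + (RtoC (INR p) + la) * x) * L) ^ p / INR (fact p))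
      by (rewrite Rpow_mult_distr; field; lra).
    apply Rmult_le_compat_r; [left; apply Rinv_0_lt_compat; lra|].
    apply pow_incr. split; [apply Rmult_le_pos; [apply Cmod_ge_0|lra]|].
    pose proof (Cmod_triangle z ((RtoC (INR p) + la) * x)) as HTr.
    rewrite Cmod_mult in HTr. specialize (Hpl p). pose proof (pos_INR p).
    pose proof (Cmod_ge_0 (RtoC (INR p) + la)).
    assert (Cmod (RtoC (INR p) + la) * (L * Cmod x) <= (INR p + Cmod la) * (1/36)).
    { apply Rmult_le_compat; try lra. apply Rmult_le_pos; lra. }
    unfold be. nra.
  - intros p. rewrite Cmod_opp, Cmod_mult. specialize (Hpl p). pose proof (pos_INR p).
    pose proof (Cmod_ge_0 (RtoC (INR p) + la)).
    assert (Cmod (RtoC (INR p) + la) * (L * Cmod x) <= (INR p + Cmod la) * (1/36)).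
    { apply Rmult_le_compat; try lra. apply Rmult_le_pos; lra. }
    lra.
  - exists s. split.
    + refine (is_Cseries_ext _ _ _ _ H1). intros p. rewrite Ey. reflexivity.
    + refine (is_Cseries_ext _ _ _ _ H2). intros N.
        rewrite Ey, shifted_sum_coefficient by exact Hla.
      rewrite Cplus_0_r. ring.
Qed.

(** The series obtained by rearrangement, multiplied by [la] and increased by
    [f 0], is the Taylor series of [f] at [la * x]. *)
Lemma abel_expansion (f : C -> C) (M K : R) :
  entire f -> 0 <= M -> (forall z, Cmod (f z) <= M * exp (K * Cmod z)) ->
  forall x la : C, exp K * Cmod x <= 1/36 ->
  exists s : C,
    is_series_from 1 (fun p => (la - RtoC (INR p)) ^ (p - 1) * dpow p x
       * C_derive_n f p (RtoC (INR p) * x))%C s /\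
    f (la * x)%C = (f (RtoC 0) + la * s)%C.
Proof.
  intros Hf HM Hexp x la Hx.
  set (L := exp K) in *. assert (HL : 0 < L) by apply exp_pos.
  destruct (entire_taylor f M K Hf HM Hexp) as [HA [_ HT]].
  pose proof (Cmod_ge_0 la) as Hla0. pose proof (Cmod_ge_0 x) as Hx0.
  (* The rearrangement starts at [p = 0], where the true factor is replaced by [0]. *)
  set (g := fun p => match p with O => RtoC 0
    | S q => ((la - RtoC (INR p)) ^ q * dpow p x)%C end).
  assert (Hbe : 0 <= Cmod la / 36) by lra.
  assert (HLx : 0 <= L * Cmod x) by (apply Rmult_le_pos; lra).
  destruct (taylor_rearrangement f M L (exp (Cmod la / 36 / (1/36))) 0
    g (fun p => RtoC (INR p) * x)%C) as [s [H1 H2]].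
  - exact HM.
  - lra.
  - exact HA.
  - exact HT.
  - intros [|q].
    + simpl. rewrite Cmod_0. pose proof (exp_pos (Cmod la / 36 / (1/36))). lra.
    + eapply Rle_trans; [|apply Rmult_le_compat_l; [left; apply exp_pos|
        apply (pow_incr (1/12) (1/6)); lra]].
      replace (1/12) with (3 * (1/36)) by lra.
      eapply Rle_trans; [|apply pow_affine_le; lra].
      unfold g, dpow.
      set (p := S q).
      assert (Hp : 1 <= INR p) by (apply (le_INR 1); unfold p; lia).
      rewrite Cmod_mult, Cmod_div, !Cmod_pow, Cmod_INR by apply fact_C_neq_0.
      pose proof (INR_fact_lt_0 p).
      assert (Hlp : Cmod (la - RtoC (INR p)) <= Cmod la + INR p).
      { eapply Rle_trans; [apply Cmod_triangle|]. rewrite Cmod_opp, Cmod_INR. lra. }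
      assert (Hq : Cmod (la - RtoC (INR p)) ^ q <= (Cmod la + INR p) ^ p).
      { apply Rle_trans with ((Cmod la + INR p) ^ q).
        - apply pow_incr. split; [apply Cmod_ge_0|exact Hlp].
        - apply Rle_pow; [lra|unfold p; lia]. }
      assert (HLxp : (L * Cmod x) ^ p <= (1/36) ^ p) by (apply pow_incr; lra).
      replace (Cmod (la - RtoC (INR p)) ^ q * (Cmod x ^ p / INR (fact p)) * L ^ p)
        with (Cmod (la - RtoC (INR p)) ^ q * (L * Cmod x) ^ p / INR (fact p))
        by (rewrite Rpow_mult_distr; field; lra).
      replace (Cmod la / 36 + INR p * (1/36)) with ((Cmod la + INR p) * (1/36)) by lra.
      rewrite (Rpow_mult_distr (Cmod la + INR p)).
      apply Rmult_le_compat_r; [left; apply Rinv_0_lt_compat; lra|].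
      apply Rmult_le_compat; try assumption; apply pow_le; [apply Cmod_ge_0|exact HLx].
  - intros p. rewrite Cmod_mult, Cmod_INR. pose proof (pos_INR p).
    assert (INR p * (L * Cmod x) <= INR p * (1/36)) by (apply Rmult_le_compat_l; lra).
    lra.
  - exists s. split.
    + assert (H3 : is_series_from 1 (fun p => g p * C_derive_n f p (RtoC (INR p) * x))%C s).
      { apply is_series_from_shift; [|exact H1]. intros k Hk.
        replace k with 0%nat by lia. unfold g. ring. }
      refine (is_Cseries_ext _ _ _ _ H3). intros k.
      change (1 + k)%nat with (S k). unfold g. replace (S k - 1)%nat with k by lia. reflexivity.
    + (* compare with the Taylor series of f at la * x *)
      apply (is_series_C_unique _ _ _ (HT O (la * x)%C)).
      assert (H3 := is_Cseries_plus _ _ _ _ (is_Cseries_single (f 0))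
        (is_Cseries_scal la _ _ H2)).
      refine (is_Cseries_ext _ _ _ _ H3). intros [|n].
      * cbn [csum C_derive_n Nat.add Nat.sub]. unfold g. rewrite !dpow_0. ring.
      * rewrite csum_shift, (csum_ext _ (fun q => (la - RtoC (INR (S q))) ^ q * dpow (S q) x
           * dpow (n - q) (RtoC (INR (S q)) * x))%C) by (intros k Hk; reflexivity).
        rewrite abel_sum. change (g 0%nat) with (RtoC 0).
        change (0 + S n)%nat with (S n). unfold dpow. rewrite (Cpow_mult_l la x), (Cpow_S la).
        field. nonzero.
Qed.

(** After rearrangement every derivative of [f] at [0] except the one of order [m]
    has coefficient [0]. *)
Lemma derivative_at_0_from_samples (f : C -> C) (M K : R) :
  entire f -> 0 <= M -> (forall z, Cmod (f z) <= M * exp (K * Cmod z)) ->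
  forall (x : C) (m : nat), exp K * Cmod x <= 1/36 -> (1 <= m)%nat ->
  is_series_from m
    (fun p => RtoC (Binomial.C (p - 1) (m - 1))
       * (RtoC (-1) ^ (p - m) * RtoC (INR p) ^ (p - m) / RtoC (INR (fact p)))
       * x ^ (p - m) * C_derive_n f p (RtoC (INR p) * x))%C
    (1 / RtoC (INR (fact m)) * C_derive_n f m (RtoC 0))%C.
Proof.
  intros Hf HM Hexp x m Hx Hm.
  set (L := exp K) in *. assert (HL : 0 < L) by apply exp_pos.
  destruct (entire_taylor f M K Hf HM Hexp) as [HA [_ HT]].
  pose proof (Cmod_ge_0 x) as Hx0.
  assert (HLx : 0 <= L * Cmod x) by (apply Rmult_le_pos; lra).
  destruct m as [|q]; [lia|]. set (m := S q) in *.
  set (g := fun p => if (p <? m)%nat then RtoC 0 else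
    (RtoC (Binomial.C (p - 1) (m - 1))
       * (RtoC (-1) ^ (p - m) * RtoC (INR p) ^ (p - m) / RtoC (INR (fact p)))
       * x ^ (p - m))%C).
  destruct (taylor_rearrangement f M L ((36 * L) ^ m) 0
    g (fun p => RtoC (INR p) * x)%C) as [s [H1 H2]].
  - exact HM.
  - lra.
  - exact HA.
  - exact HT.
  - intros p. unfold g. destruct (Nat.ltb_spec p m) as [Hp|Hp].
    + rewrite Cmod_0, Rmult_0_l. apply Rmult_le_pos; apply pow_le; lra.
    + set (d := (p - m)%nat). assert (Esplit : forall t, t ^ p = t ^ m * t ^ d)
        by (intros t; rewrite <- pow_add; f_equal; unfold d; lia).
      assert (Hp1 : 1 <= INR p) by (apply (le_INR 1); unfold m in Hp; lia).
      pose proof (INR_fact_lt_0 p) as Hfp.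
      rewrite !Cmod_mult, Cmod_div, Cmod_mult, !Cmod_pow, !Cmod_INR by apply fact_C_neq_0.
      rewrite !Cmod_R, Rabs_m1, pow1, Rmult_1_l.
      destruct (binomial_le (p - 1) (m - 1)) as [B0 B1]; [unfold m in *; lia|].
      rewrite Rabs_right by lra.
      assert (B2 : Binomial.C (p - 1) (m - 1) <= 2 ^ p).
      { eapply Rle_trans; [exact B1|]. apply Rle_pow; [lra|lia]. }
      assert (HLxd : (L * Cmod x) ^ d <= (1/36) ^ d) by (apply pow_incr; lra).
      assert (Hpd : INR p ^ d <= INR p ^ p) by (apply Rle_pow; [lra|unfold d; lia]).
      pose proof (pow_affine_le 0 (1/36) p ltac:(lra) ltac:(lra)) as HE.
      replace (0 / (1/36)) with 0 in HE by field.
      rewrite exp_0, Rplus_0_l, Rmult_1_l, (Rpow_mult_distr (INR p)) in HE.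
      pose proof (pow_lt L m HL) as HLm.
      assert (Hpp : 0 <= INR p ^ d) by (apply pow_le; lra).
      assert (Hi : 0 < / INR (fact p)) by (apply Rinv_0_lt_compat, Hfp).
      replace (Binomial.C (p - 1) (m - 1) * (INR p ^ d / INR (fact p)) * Cmod x ^ d * L ^ p)
        with (Binomial.C (p - 1) (m - 1) * (INR p ^ d * ((L * Cmod x) ^ d * (L ^ m * / INR (fact p)))))
        by (rewrite (Esplit L), Rpow_mult_distr; field; lra).
      apply Rle_trans with (2 ^ p * (INR p ^ p * ((1/36) ^ d * (L ^ m * / INR (fact p))))).
      * apply Rmult_le_compat; [exact B0| |exact B2|].
        { apply Rmult_le_pos; [exact Hpp|]. apply Rmult_le_pos; [apply pow_le, HLx|].
          apply Rmult_le_pos; lra. }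
        apply Rmult_le_compat; [exact Hpp| |exact Hpd|].
        { apply Rmult_le_pos; [apply pow_le, HLx|]. apply Rmult_le_pos; lra. }
        apply Rmult_le_compat_r; [apply Rmult_le_pos; lra|exact HLxd].
      * replace (2 ^ p * (INR p ^ p * ((1 / 36) ^ d * (L ^ m * / INR (fact p)))))
          with ((36 * L) ^ m * (2 ^ p * (INR p ^ p * (1/36) ^ p / INR (fact p)))).
        2:{ rewrite (Rpow_mult_distr 36), (Esplit (1/36)).
            replace (36 ^ m) with (/ (1/36) ^ m) by (rewrite <- pow_inv; f_equal; field).
            field. split; [lra|]. apply pow_nonzero. lra. }
        apply Rmult_le_compat_l; [apply pow_le; lra|].
        replace (1/6) with (2 * (3 * (1/36))) by lra. rewrite (Rpow_mult_distr 2).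
        apply Rmult_le_compat_l; [apply pow_le; lra|exact HE].
  - intros p. rewrite Cmod_mult, Cmod_INR. pose proof (pos_INR p).
    assert (INR p * (L * Cmod x) <= INR p * (1/36)) by (apply Rmult_le_compat_l; lra).
    lra.
  - assert (g0 : forall k, (k < m)%nat -> g k = RtoC 0).
    { intros k Hk. unfold g. destruct (Nat.ltb_spec k m); [reflexivity|lia]. }
    assert (gm : forall k, g (m + k)%nat = (RtoC (Binomial.C (q + k) q)
       * (RtoC (-1) ^ k * RtoC (INR (S q + k)) ^ k / RtoC (INR (fact (S q + k)))) * x ^ k)%C).
    { intros k. unfold g. destruct (Nat.ltb_spec (m + k) m); [lia|].
      replace (m + k - m)%nat with k by lia. unfold m.
      replace (S q + k - 1)%nat with (q + k)%nat by lia.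
      replace (S q - 1)%nat with q by lia. reflexivity. }
    assert (Es : s = (1 / RtoC (INR (fact m)) * C_derive_n f m 0)%C).
    { apply (is_series_from_shift m) in H2.
      2:{ intros k Hk. rewrite csum_zero; [apply Cmult_0_r|].
          intros j Hj. rewrite g0 by lia. ring. }
      apply (is_series_C_unique _ _ _ H2).
      set (v := (1 / RtoC (INR (fact m)) * C_derive_n f m 0)%C).
      apply (is_Cseries_ext (fun d => match d with O => v | S _ => RtoC 0 end)).
      - intros d. replace (S (m + d)) with (m + S d)%nat by lia.
        rewrite csum_split, csum_zero, Cplus_0_l.
        2:{ intros k Hk. rewrite g0 by exact Hk. ring. }
        rewrite (csum_ext _ (fun k => RtoC (Binomial.C (q + k) q)
          * (RtoC (-1) ^ k * RtoC (INR (S q + k)) ^ k / RtoC (INR (fact (S q + k)))) * x ^ k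
          * dpow (d - k) (RtoC (INR (S q + k)) * x))%C).
        2:{ intros k Hk. rewrite gm. replace (m + d - (m + k))%nat with (d - k)%nat by lia.
            reflexivity. }
        rewrite sampled_derivative_coefficient. destruct d as [|d].
        + rewrite Nat.add_0_r. unfold v. fold m. ring.
        + ring.
      - apply is_Cseries_single. }
    rewrite <- Es.
    assert (H3 : is_series_from m (fun p => g p * C_derive_n f p (RtoC (INR p) * x))%C s).
    { apply is_series_from_shift; [|exact H1]. intros k Hk. rewrite g0 by exact Hk. ring. }
    refine (is_Cseries_ext _ _ _ _ H3). intros k. cbv beta. unfold g.
    destruct (Nat.ltb_spec (m + k) m); [lia|]. reflexivity.
Qed.

Theorem proposition2p3 (f : C -> C)
    (f_entire : entire f) (f_exp : exponential_type f) :
  exists A : C -> Prop,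
    (symmetric_set A /\ convex_set A /\ compact_set A /\ locally (RtoC 0) A) /\
    (forall x y z lambda : C, A x ->
       (forall n : nat, lambda <> (- RtoC (INR n))%C) ->
       exists s : C,
         is_series_from 0
           (fun p : nat =>
              (1 / (RtoC (INR p) + lambda)
               * ((z + (RtoC (INR p) + lambda) * x) ^ p / RtoC (INR (fact p)))
               * C_derive_n f p (y - (RtoC (INR p) + lambda) * x))%C) s /\
         is_series_from 0
           (fun p : nat =>
              (1 / (RtoC (INR p) + lambda)
               * (z ^ p / RtoC (INR (fact p)))
               * C_derive_n f p y)%C) s) /\
    (forall x lambda : C, A x ->
       exists s : C,
         is_series_from 1
           (fun p : nat =>
              ((lambda - RtoC (INR p)) ^ (p - 1)
               * (x ^ p / RtoC (INR (fact p)))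
               * C_derive_n f p (RtoC (INR p) * x))%C) s /\
         f (lambda * x)%C = (f (RtoC 0) + lambda * s)%C) /\
    (forall (x : C) (m : nat), A x -> (1 <= m)%nat ->
       is_series_from m
         (fun p : nat =>
            (RtoC (Binomial.C (p - 1) (m - 1))
             * (RtoC (-1) ^ (p - m) * RtoC (INR p) ^ (p - m)
                / RtoC (INR (fact p)))
             * x ^ (p - m)
             * C_derive_n f p (RtoC (INR p) * x))%C)
         (1 / RtoC (INR (fact m)) * C_derive_n f m (RtoC 0))%C).
Proof.
  destruct f_exp as [M [K [HM [HK Hexp]]]].
  assert (HM' : 0 <= M) by lra. assert (HK' : 0 <= K) by lra.
  assert (HL : 0 < exp K) by apply exp_pos.
  (* A point of the square of half-side r has modulus at most 2 r, and the series
     identities are available as soon as exp K times the modulus is at most 1/36. *)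
  assert (Hr : 0 < / (72 * exp K)) by (apply Rinv_0_lt_compat; lra).
  assert (Hsmall : forall x, square (/ (72 * exp K)) x -> exp K * Cmod x <= 1/36).
  { intros x Hx. apply square_Cmod in Hx.
    apply Rle_trans with (exp K * (2 * / (72 * exp K))).
    - apply Rmult_le_compat_l; lra.
    - right. field. lra. }
  exists (square (/ (72 * exp K))). split; [|split; [|split]].
  - split; [apply square_symmetric|]. split; [apply square_convex|].
    split; [apply square_compact; lra|apply square_neighbourhood, Hr].
  - intros x y z lambda Hx Hlambda.
    apply (shifted_taylor_series f M K f_entire HM' Hexp HK' x y z lambda (Hsmall x Hx)).
    intros n E. apply (Hlambda n). apply Ceq_minus. rewrite <- E. ring.
  - intros x lambda Hx.
    exact (abel_expansion f M K f_entire HM' Hexp x lambda (Hsmall x Hx)).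
  - intros x m Hx Hm.
    exact (derivative_at_0_from_samples f M K f_entire HM' Hexp x m (Hsmall x Hx) Hm).
Qed.
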